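(* Let $n\ge 1$ be an integer, $p,q\in[1,\infty)$ and $\lambda,\sigma,\alpha,\beta\in(0,\infty)$. Assume that $$\left(p>1\text{ and }0<\alpha<\tfrac{n+2}{2p}\right)\ \text{ or }\ \left(p=1\text{ and }0<\alpha\le\tfrac{n+2}{2p}\right),$$ $$\left(q>1\text{ and }0<\beta<\tfrac{n+2}{2q}\right)\ \text{ or }\ \left(q=1\text{ and }0<\beta\le\tfrac{n+2}{2q}\right),$$ that $(n+2-2p\alpha)q^2\sigma\le(n+2-2q\beta)p^2\lambda$, that $2p\alpha<n+2$, and that $\sigma<1/\lambda$. Suppose $u\in Y^p_\alpha$ and $v\in Y^q_\beta$ are (necessarily nonnegative) solutions of $$0\le(\partial_t-\Delta)^\alpha u\le v^\lambda,\qquad 0\le(\partial_t-\Delta)^\beta v\le u^\sigma\qquad\text{in }\mathbb{R}^n\times\mathbb{R},$$ $$u=v=0\quad\text{in }\mathbb{R}^n\times(-\infty,0).$$ Then for all $T>0$ $$\|u\|_{L^\infty(\mathbb{R}^n\times(0,T))}\le M_2^{\frac{\lambda}{1-\lambda\sigma}}T^{\gamma_2/\sigma}\quad\text{and}\quad\|v\|_{L^\infty(\mathbb{R}^n\times(0,T))}\le M_1^{\frac{\sigma}{1-\lambda\sigma}}T^{\gamma_1/\lambda},$$ where $$\gamma_1=\frac{(\beta+\alpha\sigma)\lambda}{1-\lambda\sigma},\qquad\gamma_2=\frac{(\alpha+\beta\lambda)\sigma}{1-\lambda\sigma},$$ $$M_1=\frac{\Gamma(\gamma_1+1)\Gamma(\gamma_2+1)^{1/\sigma}}{\Gamma(\alpha+\gamma_1+1)\Gamma(\beta+\gamma_2+1)^{1/\sigma}},\qquad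 M_2=\frac{\Gamma(\gamma_2+1)\Gamma(\gamma_1+1)^{1/\lambda}}{\Gamma(\beta+\gamma_2+1)\Gamma(\alpha+\gamma_1+1)^{1/\lambda}},$$ and $\Gamma$ is the Gamma function.
   Context: For $p\ge1$, $X^p:=\bigcap_{T\in\mathbb{R}}L^p(\mathbb{R}^n\times(-\infty,T))$, i.e. the set of measurable $f:\mathbb{R}^n\times\mathbb{R}\to\mathbb{R}$ with $\|f\|_{L^p(\mathbb{R}^n\times(-\infty,T))}<\infty$ for all $T\in\mathbb{R}$ (functions equal a.e. are identified). For $\alpha>0$ the fractional heat kernel is $$\Phi_\alpha(x,t):=\frac{t^{\alpha-1}}{\Gamma(\alpha)}\frac{1}{(4\pi t)^{n/2}}e^{-|x|^2/(4t)}\chi_{(0,\infty)}(t),$$ and $$J_\alpha f(x,t):=\iint_{\mathbb{R}^n\times(-\infty,t)}\Phi_\alpha(x-\xi,t-\tau)f(\xi,\tau)\,d\xi\,d\tau .$$ Set $Y^p_\alpha:=J_\alpha(X^p)$. When ($p>1$ and $0<\alpha<\frac{n+2}{2p}$) or ($p=1$ and $0<\alpha\le\frac{n+2}{2p}$), it is known that $J_\alpha f\in L^p_{\rm loc}(\mathbb{R}^n\times\mathbb{R})$ for $f\in X^p$ and that $J_\alpha:X^p\to Y^p_\alpha$ is one-to-one and onto; the fully fractional heat operator $(\partial_t-\Delta)^\alpha:Y^p_\alpha\to X^p$ is defined as the inverse of $J_\alpha:X^p\to Y^p_\alpha$. Likewise $(\partial_t-\Delta)^\beta:Y^q_\beta\to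 X^q$ is the inverse of $J_\beta:X^q\to Y^q_\beta$. *)

(* Defs.v *)
From HB Require Import structures.
From mathcomp Require Import all_boot all_order all_algebra.
From mathcomp Require Import all_classical all_reals all_analysis.

Set Implicit Arguments.
Unset Strict Implicit.
Unset Printing Implicit Defensive.
Import Order.TTheory GRing.Theory Num.Theory.
Import numFieldNormedType.Exports.
Local Open Scope classical_set_scope.
Local Open Scope ring_scope.

Lemma product_sigma_finite d1 d2 (T1 : measurableType d1)
    (T2 : measurableType d2) (R : realType)
    (m1 : {sigma_finite_measure set T1 -> \bar R})
    (m2 : {sigma_finite_measure set T2 -> \bar R}) :
  sigma_finite setT (m1 \x m2)%E.
Proof.
have /sigma_finiteP[F [TF ndF Foo]] := sigma_finiteT m1.
have /sigma_finiteP[G [TG ndG Goo]] := sigma_finiteT m2.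
exists (fun n => F n `*` G n).
  rewrite -setXTT TF TG predeqE => -[x y]; split.
    move=> [/= [n _ Fnx] [k _ Gky]]; exists (maxn n k) => //; split.
    - by move: x Fnx; exact/subsetPset/ndF/leq_maxl.
    - by move: y Gky; exact/subsetPset/ndG/leq_maxr.
  by move=> [n _ []/= ? ?]; split; exists n.
move=> k; have [? ?] := Foo k; have [? ?] := Goo k.
split; first exact: measurableX.
by rewrite product_measure1E// lte_mul_pinfty// ge0_fin_numE.
Qed.

Section lebesgue_measure_Rn.
Context (R : realType).
Local Notation B := (measurableTypeR R).

Definition cons_tuple n (z : B * n.-tuple B) : n.+1.-tuple B :=
  [the n.+1.-tuple B of z.1 :: z.2].

Lemma measurable_cons_tuple n : measurable_fun setT (@cons_tuple n).
Proof. exact: measurable_cons. Qed.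

Section step.
Context n (mu : {sigma_finite_measure set (n.-tuple B) -> \bar R}).

Definition lebesgue_cons : set (n.+1.-tuple B) -> \bar R :=
  pushforward (lebesgue_measure \x mu)%E (@cons_tuple n).

Let lebesgue_cons0 : lebesgue_cons set0 = 0%E.
Proof. by rewrite /lebesgue_cons /pushforward preimage_set0 measure0. Qed.

Let lebesgue_cons_ge0 A : (0 <= lebesgue_cons A)%E.
Proof. by rewrite /lebesgue_cons /pushforward measure_ge0. Qed.

Let lebesgue_cons_sigma_additive : semi_sigma_additive lebesgue_cons.
Proof.
move=> F mF tF mUF; rewrite /lebesgue_cons /pushforward preimage_bigcup.
apply: measure_semi_sigma_additive.
- by move=> k; rewrite -[X in measurable X]setTI; exact: measurable_cons_tuple.
- apply/trivIsetP => /= i j _ _ ij; rewrite -preimage_setI.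
  by move/trivIsetP : tF => /(_ _ _ _ _ ij) ->//; rewrite preimage_set0.
- rewrite -preimage_bigcup -[X in measurable X]setTI.
  exact: measurable_cons_tuple.
Qed.

HB.instance Definition _ := isMeasure.Build _ _ _ lebesgue_cons
  lebesgue_cons0 lebesgue_cons_ge0 lebesgue_cons_sigma_additive.

Let lebesgue_cons_sigma_finite : sigma_finite setT lebesgue_cons.
Proof.
have [F FT Foo] := product_sigma_finite (@lebesgue_measure R) mu.
pose g (x : n.+1.-tuple B) : B * n.-tuple B := (thead x, [tuple of behead x]).
have mg : measurable_fun setT g.
  apply/measurable_fun_pair; first exact: measurable_tnth.
  exact: measurable_behead.
have consK : cancel (@cons_tuple n) g.
  by move=> [x t]; rewrite /g theadE; congr pair; exact/val_inj.
exists (fun i => g @^-1` F i).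
  by rewrite -preimage_bigcup -FT preimage_setT.
move=> i; have [mF Fi] := Foo i; split.
  by rewrite -[X in measurable X]setTI; exact: mg.
rewrite /lebesgue_cons /pushforward -comp_preimage.
by rewrite (_ : g \o _ = id)//; apply/funext => z /=; rewrite consK.
Qed.

HB.instance Definition _ := Measure_isSigmaFinite.Build _ _ _ lebesgue_cons
  lebesgue_cons_sigma_finite.

End step.

(* Lebesgue measure on the Borel sets of R^n, as the n-fold product of the
   one-dimensional one; R^0 carries the unit point mass. *)
Fixpoint lebesgue_tuple n : {sigma_finite_measure set (n.-tuple B) -> \bar R} :=
  if n is m.+1 then lebesgue_cons (lebesgue_tuple m) else \d_[tuple].

Lemma lebesgue_tuple_box n (A : 'I_n -> set B) :
  (forall i, measurable (A i)) ->
  lebesgue_tuple n [set x | forall i, A i (tnth x i)] =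
  (\prod_(i < n) lebesgue_measure (A i))%E.
Proof.
elim: n A => [|n IH] A mA.
  rewrite big_ord0 /= diracE mem_set//=.
  by move=> [].
rewrite big_ord_recl -IH//= /lebesgue_cons /pushforward.
have mB : measurable [set x : n.-tuple B | forall i, A (lift ord0 i) (tnth x i)].
  rewrite (_ : [set _ | _] =
      \bigcap_(i in [set: 'I_n]) ((@tnth n B ^~ i) @^-1` A (lift ord0 i))).
    apply: fin_bigcap_measurable => // i _.
    rewrite -[X in measurable X]setTI.
    exact: measurable_tnth (measurableT) _ (mA _).
  by apply/seteqP; split => x /= xA i *; exact: xA.
rewrite -product_measure1E; [|exact: mA|exact: mB].
congr (product_measure1 _ _ _).
apply/seteqP; split => -[x t] /=.
  move=> h; split; first exact: (h ord0).
  by move=> i; have := h (lift ord0 i); rewrite tnthS.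
move=> [xA tA] i; case: (unliftP ord0 i) => [j ->|->//].
by rewrite tnthS.
Qed.

End lebesgue_measure_Rn.

Notation spacetime R n := (n.-tuple (measurableTypeR R) * measurableTypeR R)%type.

Section spacetime_measure.
Context (R : realType) (n : nat).

Definition spacetime_measure : set (spacetime R n) -> \bar R :=
  (lebesgue_tuple R n \x lebesgue_measure)%E.
HB.instance Definition _ := Measure.on spacetime_measure.
HB.instance Definition _ := Measure_isSigmaFinite.Build _ _ _ spacetime_measure
  (product_sigma_finite (lebesgue_tuple R n) (@lebesgue_measure R)).

End spacetime_measure.
Arguments spacetime_measure : clear implicits.

Definition Gamma (R : realType) (s : R) : R :=
  (\int[lebesgue_measure]_(t in `]0%R, +oo[) (t `^ (s - 1) * expR (- t)))%R.

Section fractional_heat.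
Context (R : realType) (n : nat).
Local Notation mu := (spacetime_measure R n).
Implicit Types (f u : spacetime R n -> R) (p alpha T : R).

Definition X_space p : set (spacetime R n -> R) :=
  [set f | measurable_fun setT f /\
     forall T, finite_norm mu p%:E (f \_ [set z | (z.2 : R) < T])].

Definition heat_kernel alpha (x : n.-tuple (measurableTypeR R)) (t : R) : R :=
  if 0 < t then
    t `^ (alpha - 1) / Gamma alpha * ((4 * pi * t) `^ (n%:R / 2))^-1 *
    expR (- (\sum_(i < n) (tnth x i : R) ^+ 2) / (4 * t))
  else 0.

(* The value is finite exactly when the integral converges absolutely: the
   library integral of a function whose positive and negative parts both have
   infinite integral is -oo. *)
Definition J_heat alpha f (z : spacetime R n) : \bar R :=
  (\int[mu]_(w in [set w : spacetime R n | (w.2 < z.2 :> R)%R])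
    (heat_kernel alpha [tuple (tnth z.1 i : R) - tnth w.1 i | i < n] (z.2 - w.2)
     * f w)%:E)%E.

(* The elements of X_space and Y_space are representatives of classes modulo
   equality almost everywhere; every class of Lebesgue measurable functions has
   a Borel representative, as X_space requires. *)
Definition Y_space alpha p : set (spacetime R n -> R) :=
  [set u | exists2 f, X_space p f & EFin \o u = J_heat alpha f %[ae mu]].

(* The inverse of J_heat alpha : X_space p -> Y_space alpha p. When that map is
   one-to-one, the chosen representative is unique up to a null set. *)
Definition frac_heat alpha p u : spacetime R n -> R :=
  xget (cst 0)
    [set f | X_space p f /\ EFin \o u = J_heat alpha f %[ae mu]].

(* Extending by zero outside the slab R^n x (0, T) does not change the essential
   supremum of |u|, nor the L^p norms used in X_space. *)
Definition Linfty_norm T u : \bar R :=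
  'N[mu]_+oo[EFin \o (u \_ [set z | 0 < (z.2 : R) < T])].

End fractional_heat.

(* Main.v *)
(* With f = (d_t - Delta)^alpha u and g = (d_t - Delta)^beta v, both f and g vanish
   for t <= 0, u = J_alpha f <= J_alpha (v^lambda) and v = J_beta g <= J_beta (u^sigma).

   One of lambda, sigma is at most 1, say lambda.  Since the kernel has mass
   c T^alpha on a slab of height T, Jensen and Tonelli bound J_alpha on
   L^s(t < T), s >= 1, by a multiple of T^alpha.  Hence each round trip
   v -> u -> v raises the exponent s to s / (lambda sigma), and the ratios
   ||v||_s^s / E^s stay bounded along this sequence for a suitable
   E = C T^((beta + alpha sigma) / (1 - lambda sigma)).  As s tends to infinity
   this gives v <= E on t < T for every T, that is v <= C' t^b with the exponent b
   of the self-similar solution.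

   J_alpha acts on powers of t through the Beta integral, so inserting this bound
   into the system sends the constant C to C^(lambda sigma) L^(1 - lambda sigma);
   iterating, C tends to the sharp constant L. *)
From HB Require Import structures.
Require Import Defs.
From mathcomp Require Import all_boot all_order all_algebra.
From mathcomp Require Import all_classical all_reals all_analysis.
From mathcomp Require Import measurable_realfun ess_sup_inf lra.

Set Implicit Arguments.
Unset Strict Implicit.
Unset Printing Implicit Defensive.
Import Order.TTheory GRing.Theory Num.Theory.
Import numFieldNormedType.Exports.
Local Open Scope classical_set_scope.
Local Open Scope ring_scope.

(** * Gamma and Beta integrals *)

Section real_line.
Context {R : realType}.
Local Notation mu := (@lebesgue_measure R).
Implicit Types (a b s t : R).

Lemma measurable_affine a b : measurable_fun setT (fun x : R => a * x + b).
Proof. by apply: measurable_funD => //; exact: measurable_funM. Qed.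

(** The image of Lebesgue measure under x -> a x + b, scaled by a, gives half-open intervals their
    length, hence is Lebesgue measure by uniqueness. *)
Lemma ge0_integral_affine (f : R -> \bar R) a b :
  measurable_fun setT f -> (forall x, (0 <= f x)%E) -> 0 < a ->
  (\int[mu]_x f x = a%:E * \int[mu]_x f (a * x + b)%R)%E.
Proof.
move=> mf f0 a0.
pose phi : measurableTypeR R -> measurableTypeR R := fun x => a * x + b.
have mphi : measurable_fun setT phi by exact: measurable_affine.
pose aN := NngNum (ltW a0).
pose nu' : {measure set (measurableTypeR R) -> \bar R} :=
  mscale aN (pushforward mu phi).
pose nu := nu' mphi.
have E : forall A, measurable A -> mu A = nu A.
  apply: lebesgue_measure_unique => X [[c d]] _ <-/=.
  rewrite /nu /nu' /= /mscale/= /pushforward.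
  rewrite (_ : phi @^-1` _ = `](c - b) / a, (d - b) / a]%classic).
    rewrite !lebesgue_measure_itv/= !lte_fin ltr_pM2r ?invr_gt0// ltrD2r.
    case: ifP => _; last by rewrite mule0.
    by rewrite -!EFinD -EFinM; congr EFin; rewrite /= -mulrBl mulrCA divff ?gt_eqF//; lra.
  apply/seteqP; split => x; rewrite /phi /= !in_itv/= ltr_pdivrMr// ler_pdivlMr//.
    by rewrite mulrC; move=> /andP[*]; apply/andP; split; lra.
  by rewrite mulrC; move=> /andP[*]; apply/andP; split; lra.
transitivity (\int[nu]_x f x)%E.
  by apply: eq_measure_integral => A mA _; exact: E.
rewrite ge0_integral_mscale//; congr (_ * _)%E.
by rewrite ge0_integral_pushforward// => y _.
Qed.

Lemma ge0_integral_reflect (f : R -> \bar R) b :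
  measurable_fun setT f -> (forall x, (0 <= f x)%E) ->
  (\int[mu]_x f x = \int[mu]_x f (b - x)%R)%E.
Proof.
move=> mf f0; rewrite (ge0_integral_affine b mf f0 ltr01) mul1e.
have mf1 : measurable_fun setT (fun x : R => f (1 * x + b)).
  by apply: (measurableT_comp mf); exact: measurable_affine.
transitivity (\int[pushforward mu (-%R : measurableTypeR R -> measurableTypeR R)]_x f (1 * x + b)%R)%E.
  by apply: eq_measure_integral => // A mA _; exact/esym/lebesgue_measureN.
rewrite ge0_integral_pushforward//= preimage_setT.
by apply: eq_integral => x _; rewrite /= mul1r addrC.
Qed.

(** Unlike [powR], it vanishes at all t <= 0 for every s: [ppow 0] is the indicator of t > 0, and
    integrals over 0 < x < t become convolutions on the whole line. *)
Definition ppow s t : R := if 0 < t then t `^ s else 0.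

Lemma ppow_ge0 s t : 0 <= ppow s t.
Proof. by rewrite /ppow; case: ifP => // _; exact: powR_ge0. Qed.

Lemma ppow_le0 s t : t <= 0 -> ppow s t = 0.
Proof. by rewrite /ppow ltNge => ->. Qed.

Lemma ppow_gt0 s t : 0 < t -> ppow s t = t `^ s.
Proof. by rewrite /ppow => ->. Qed.

Lemma measurable_ppow s : measurable_fun setT (ppow s).
Proof.
apply: measurable_fun_ifT; [|exact: measurable_powR|exact: measurable_cst].
by apply: measurable_fun_ltr.
Qed.

Lemma ppow0 t : ppow 0 t = (0 < t)%R%:R.
Proof. by rewrite /ppow; case: ifP => _ //; rewrite powRr0. Qed.

(** An antiderivative is t^s / s; the lower end e > 0 keeps away from the singularity at 0. *)
Lemma integral_powR_le (s e : R) : 0 < s -> 0 < e < 1 ->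
  (\int[mu]_(t in `[e, 1%R]) (t `^ (s - 1))%:E <= s^-1%:E)%E.
Proof.
move=> s0 /andP[e0 e1].
have D (r x : R) : 0 < x -> is_derive x 1 (@powR R ^~ r) (r * x `^ (r - 1)).
  move=> x0; have xI : x \in `]0, +oo[%R by rewrite in_itv/= x0.
  by split; [exact: derivable_powR|rewrite -derive1E; exact: powR_derive1].
have C (r x : R) : 0 < x -> {for x, continuous (@powR R ^~ r)}.
  by move=> x0; apply/differentiable_continuous/derivable1_diffP; case: (D r _ x0).
have D' (x : R) : 0 < x -> is_derive x 1 (fun t => s^-1 * t `^ s) (x `^ (s - 1)).
  move=> x0; have Dx := D s x x0.
  apply: is_derive_eq; rewrite /GRing.scale/= mulrA mulVf ?mul1r//.
  by rewrite gt_eqF.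
have C' (x : R) : 0 < x -> {for x, continuous (fun t => s^-1 * t `^ s)}.
  by move=> x0; apply/differentiable_continuous/derivable1_diffP; case: (D' _ x0).
rewrite (@continuous_FTC2 _ _ (fun t => s^-1 * t `^ s))//.
- by rewrite -EFinD lee_fin powR1 mulr1 gerBl mulr_ge0 ?powR_ge0// invr_ge0 ltW.
- apply: continuous_in_subspaceT => x /[!inE]/=; rewrite in_itv/= => /andP[ex _].
  by apply: C; exact: lt_le_trans ex.
- split.
  + by move=> x; rewrite in_itv/= => /andP[ex _]; case: (D' x (lt_trans e0 ex)).
  + by apply: cvg_at_right_filter; exact: (C' e).
  + by apply: cvg_at_left_filter; exact: (C' 1).
- move=> x; rewrite in_itv/= => /andP[ex _].
  by rewrite derive1E; case: (D' x (lt_trans e0 ex)).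
Qed.

(** Monotone convergence along closed intervals exhausting []0, 1]]. *)
Lemma integral_ppow01_le s : 0 < s ->
  (\int[mu]_(t in `]0%R, 1%R]) (t `^ (s - 1))%:E <= s^-1%:E)%E.
Proof.
move=> s0.
(* With k + 2 the lower end is strictly below 1 already for k = 0. *)
pose F (k : nat) : set R := `[k.+2%:R^-1, 1]%classic.
have FE : `]0%R, 1%R]%classic = \bigcup_k F k.
  apply/seteqP; split => x /=.
    rewrite in_itv/= => /andP[x0 x1]; exists (Num.bound x^-1) => //.
    rewrite /F/= in_itv/= x1 andbT invf_ple ?posrE// ltW//.
    apply: (lt_trans (archi_boundP _)); first by rewrite invr_ge0 ltW.
    by rewrite ltr_nat.
  move=> [k _]; rewrite /F/= !in_itv/= => /andP[x0 ->].
  by rewrite (lt_le_trans _ x0)// invr_gt0.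
have mp (D : set R) : measurable_fun D (fun t => (t `^ (s - 1))%:E).
  by apply/measurable_EFinP; apply: measurable_funTS; exact: measurable_powR.
have ndF : nondecreasing_seq F.
  move=> m k mk; apply/subsetPset => x; rewrite /F/= !in_itv/= => /andP[kx ->].
  by rewrite andbT (le_trans _ kx)// lef_pV2 ?posrE// ler_nat.
have g0 k x : F k x -> (0 <= (x `^ (s - 1))%:E)%E by rewrite lee_fin powR_ge0.
have mF k : measurable (F k) by exact: measurable_itv.
rewrite FE.
have /cvg_lim <- // : (\int[mu]_(t in F k) (t `^ (s - 1))%:E)%E @[k --> \oo] -->
    (\int[mu]_(t in \bigcup_k F k) (t `^ (s - 1))%:E)%E.
  apply: ge0_nondecreasing_set_cvg_integral => //; by move=> *; exact: mp.
apply: lime_le.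
  apply: ereal_nondecreasing_is_cvgn.
  apply: ge0_nondecreasing_set_nondecreasing_integral => //; by move=> *; exact: mp.
near=> k; apply: integral_powR_le => //.
by rewrite invr_gt0 ltr0n/= invf_lt1// ltr1n.
Unshelve. all: by end_near. Qed.

Definition Gamma_fun s t : R := ppow (s - 1) t * expR (- t).

Lemma measurable_Gamma_fun s : measurable_fun setT (Gamma_fun s).
Proof.
apply: measurable_funM; first exact: measurable_ppow.
by apply: measurableT_comp => //; exact: measurable_expR.
Qed.

Lemma Gamma_fun_ge0 s t : 0 <= Gamma_fun s t.
Proof. by rewrite mulr_ge0 ?ppow_ge0 ?expR_ge0. Qed.

(** Up to 1 the integrand is at most t^(s-1); beyond 1 the power is absorbed by e^(t/2), which
    leaves a multiple of the exponential density of rate 1/2. *)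
Lemma integral_Gamma_fun_lty s : 0 < s ->
  (\int[mu]_t (Gamma_fun s t)%:E < +oo)%E.
Proof.
move=> s0.
(* N > s gives t^(s-1) <= t^(N+1) for t >= 1, and [C] comes from the term of degree N + 1 in the
   series of e^(t/2). *)
pose N := Num.bound s.
pose C : R := 2 ^+ N.+1 * N.+1`!%:R.
have C0 : 0 <= C by rewrite mulr_ge0.
have H t : 1 <= t -> t `^ (s - 1) <= C * expR (t / 2).
  move=> t1; apply: (@le_trans _ _ (t ^+ N.+1)).
    rewrite -powR_mulrn; last by lra.
    apply: ler_powR => //; have := archi_boundP (ltW s0).
    rewrite -/N => sN; have : (N%:R : R) <= N.+1%:R by rewrite ler_nat.
    lra.
  have := @expR_ge1Dxn R (t / 2) N; rewrite expr_div_n => /(_ ltac:(lra)) h.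
  have {h} : t ^+ N.+1 / 2 ^+ N.+1 / N.+1`!%:R <= expR (t / 2) by lra.
  rewrite -mulrA -invfM ler_pdivrMr; first by rewrite mulrC.
  by rewrite mulr_gt0 ?exprn_gt0 ?ltr0n ?fact_gt0.
pose f1 t : \bar R := ((fun t => (t `^ (s - 1))%:E) \_ `]0%R, 1%R]) t.
pose f2 t : \bar R := ((2 * C)%:E * (exponential_pdf 2^-1 t)%:E)%E.
have f10 t : (0 <= f1 t)%E.
  by rewrite /f1; apply: erestrict_ge0 => x _; rewrite lee_fin powR_ge0.
have f20 t : (0 <= f2 t)%E.
  apply: mule_ge0; rewrite lee_fin; first exact: mulr_ge0.
  by apply: exponential_pdf_ge0.
have mf1 : measurable_fun setT f1.
  apply/(measurable_restrictT (fun t : R => (t `^ (s - 1))%:E)) => //.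
  by apply/measurable_EFinP; apply: measurable_funTS; exact: measurable_powR.
have mE : measurable_fun setT (fun t : R => (exponential_pdf (2^-1 : R) t)%:E).
  by apply/measurable_EFinP; apply: measurable_exponential_pdf.
have mf2 : measurable_fun setT f2 by exact: measurable_funeM.
apply: (@le_lt_trans _ _ (\int[mu]_t (f1 t + f2 t))%E).
  apply: ge0_le_integral => //.
  - by move=> t _; rewrite lee_fin Gamma_fun_ge0.
  - by apply/measurable_EFinP; exact: measurable_Gamma_fun.
  - exact: emeasurable_funD.
  move=> t _; rewrite /Gamma_fun /ppow; case: ifPn => t0; last first.
    by rewrite mul0r adde_ge0.
  have [t1|t1] := leP t 1.
    rewrite -[leLHS]adde0 leeD// /f1 patchE mem_set/= ?in_itv/= ?t0//.
    rewrite lee_fin ler_piMr ?powR_ge0// -[leRHS]expR0 ler_expR; lra.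
  rewrite -[leLHS]add0e leeD// /f2 -EFinM lee_fin exponential_pdfE ?(ltW t0)//.
  apply: (@le_trans _ _ (C * expR (t / 2) * expR (- t))).
    by rewrite ler_pM2r ?expR_gt0// H// ltW.
  rewrite -mulrA -expRD mulrACA divff// mul1r.
  by rewrite (_ : t / 2 - t = - 2^-1 * t)//; lra.
rewrite ge0_integralD// lte_add_pinfty//.
  rewrite /f1 -integral_mkcond.
  by rewrite (le_lt_trans (integral_ppow01_le s0))// ltry.
rewrite ge0_integralZl//.
- by rewrite integral_exponential_pdf ?mule1 ?ltry// invr_gt0.
- by move=> t _; rewrite lee_fin; apply: exponential_pdf_ge0.
- by rewrite lee_fin mulr_ge0.
Qed.

(** [Gamma] is a real-valued integral, which would be 0 if it diverged; finiteness identifies it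
    with the extended one. *)
Lemma integral_Gamma_fun s : 0 < s ->
  (\int[mu]_t (Gamma_fun s t)%:E = (Gamma s)%:E)%E.
Proof.
move=> s0; rewrite /Gamma /Rintegral integral_mkcond.
have E : (fun t => (Gamma_fun s t)%:E) =
    (fun t : R => (t `^ (s - 1) * expR (- t))%:E) \_ `]0%R, +oo[.
  apply/funext => t; rewrite patchE /Gamma_fun /ppow; case: ifPn => t0.
    by rewrite mem_set//= in_itv/= t0.
  by rewrite memNset ?mul0r//= in_itv/= andbT; exact/negP.
rewrite E fineK// -E ge0_fin_numE ?integral_Gamma_fun_lty//.
by apply: integral_ge0 => t _; rewrite lee_fin Gamma_fun_ge0.
Qed.

(** Were the integral zero, an integrand positive on []0, 1[] would vanish almost everywhere. *)
Lemma Gamma_gt0 s : 0 < s -> 0 < Gamma s.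
Proof.
move=> s0; rewrite -lte_fin -integral_Gamma_fun// lt0e; apply/andP; split; last first.
  by apply: integral_ge0 => t _; rewrite lee_fin Gamma_fun_ge0.
apply/eqP => I0.
have mG : measurable_fun setT (fun t => (Gamma_fun s t)%:E).
  by apply/measurable_EFinP; exact: measurable_Gamma_fun.
have /(ae_eq_integral_abs mu measurableT mG) [A [mA A0 sA]] :
    (\int[mu]_t `|(Gamma_fun s t)%:E| = 0)%E.
  by rewrite -[RHS]I0; apply: eq_integral => t _; rewrite gee0_abs// lee_fin Gamma_fun_ge0.
have : (mu `]0%R, 1%R[%classic <= mu A)%E.
  apply: le_measure; rewrite ?inE//; apply: subset_trans sA => t /=.
  rewrite in_itv/= => /andP[t0 _] /(_ I) [] /eqP; apply/negP.
  by rewrite gt_eqF// mulr_gt0 ?expR_gt0// ppow_gt0// powR_gt0.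
by rewrite A0 lebesgue_measure_itv/= lte01 sube0 leNgt lte01.
Qed.

End real_line.

Local Opaque Gamma.

Section beta.
Context {R : realType}.
Local Notation mu := (@lebesgue_measure R).
Implicit Types (a b s t : R).

Lemma ge0_integral_translate (f : R -> \bar R) b :
  measurable_fun setT f -> (forall x, (0 <= f x)%E) ->
  (\int[mu]_x f (x - b)%R = \int[mu]_x f x)%E.
Proof.
move=> mf f0; rewrite [RHS](ge0_integral_affine (- b) mf f0 ltr01) mul1e.
by apply: eq_integral => x _; rewrite mul1r.
Qed.

Let I a b t := (\int[mu]_x (ppow (a - 1) (t - x) * ppow (b - 1) x)%:E)%E.

Let I_ge0 a b t : (0 <= I a b t)%E.
Proof. by apply: integral_ge0 => x _; rewrite lee_fin mulr_ge0 ?ppow_ge0. Qed.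

(** The substitution x = t y factors out the power of t; for t <= 0 one factor of the integrand is
    always 0. *)
Let I_scale a b t : (I a b t = (ppow (a + b - 1) t)%:E * I a b 1)%E.
Proof.
have m u c : measurable_fun setT (fun x : R => ppow c (u - x)).
  apply: (measurableT_comp (measurable_ppow c)).
  by apply: measurable_funB => //; exact: measurable_cst.
have mI (u : R) : measurable_fun setT (fun x : R => (ppow (a - 1) (u - x) * ppow (b - 1) x)%:E).
  by apply/measurable_EFinP/measurable_funM => //; exact: measurable_ppow.
have [t0|t0] := leP t 0.
  rewrite [ppow _ t]ppow_le0// mul0e /I integral0_eq// => x _.
  have [x0|x0] := leP x 0; first by rewrite [X in _ * X]ppow_le0// mulr0.
  by rewrite ppow_le0 ?mul0r//; lra.
rewrite /I (ge0_integral_affine 0 (mI t) _ t0); last first.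
  by move=> x; rewrite lee_fin mulr_ge0 ?ppow_ge0.
transitivity (t%:E * \int[mu]_x ((t `^ (a - 1) * t `^ (b - 1))%:E *
    (ppow (a - 1) (1 - x) * ppow (b - 1) x)%:E))%E.
  congr (_ * _)%E; apply: eq_integral => x _; rewrite -EFinM addr0; congr EFin.
  have tp c y : ppow c (t * y) = t `^ c * ppow c y.
    rewrite /ppow pmulr_rgt0//; case: ifPn => [y0|]; last by rewrite mulr0.
    by rewrite powRM// ltW.
  rewrite (_ : t - t * x = t * (1 - x)); last by lra.
  by rewrite !tp mulrACA.
rewrite ge0_integralZl//; last 3 first.
- exact: mI.
- by move=> x _; rewrite lee_fin mulr_ge0 ?ppow_ge0.
- by rewrite lee_fin mulr_ge0 ?powR_ge0.
rewrite muleA -EFinM (ppow_gt0 _ t0); congr (_%:E * _)%E.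
have tn0 : t != 0 by rewrite gt_eqF.
rewrite -{1}(powRr1 (ltW t0)) -!powRD ?tn0 ?implybT//.
by congr (_ `^ _); lra.
Qed.

(** Euler's argument: integrate e^(-x) (x-y)^(a-1) y^(b-1) over 0 < y < x in both orders. With y
    first, scaling gives [I a b 1] times Gamma(a+b); with x first, a translation gives Gamma(a)
    Gamma(b). *)
Lemma integral_ppow_conv a b t : 0 < a -> 0 < b ->
  (\int[mu]_x (ppow (a - 1) (t - x) * ppow (b - 1) x)%:E =
   (Gamma a * Gamma b / Gamma (a + b) * ppow (a + b - 1) t)%:E)%E.
Proof.
move=> a0 b0; have ab0 : 0 < a + b by rewrite addr_gt0.
rewrite -/(I a b t) I_scale EFinM muleC; congr (_ * _)%E.
pose f (z : R * R) : \bar R := (Gamma_fun a (z.1 - z.2) * Gamma_fun b z.2)%:E.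
have mf : measurable_fun setT f.
  apply/measurable_EFinP/measurable_funM.
    by apply: (measurableT_comp (measurable_Gamma_fun a)); exact: measurable_funB.
  by apply: (measurableT_comp (measurable_Gamma_fun b)).
have f0 z : (0 <= f z)%E by rewrite lee_fin mulr_ge0 ?Gamma_fun_ge0.
have mG c : measurable_fun setT (fun x : R => (Gamma_fun c x)%:E).
  by apply/measurable_EFinP; exact: measurable_Gamma_fun.
have G0 c x : (0 <= (Gamma_fun c x)%:E :> \bar R)%E by rewrite lee_fin Gamma_fun_ge0.
have E1 : (\int[mu]_x \int[mu]_y f (x, y) = I a b 1 * (Gamma (a + b))%:E)%E.
  rewrite -(integral_Gamma_fun ab0) -ge0_integralZl//.
  apply: eq_integral => x _.
  transitivity (\int[mu]_y ((expR (- x))%:E *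
      (ppow (a - 1) (x - y) * ppow (b - 1) y)%:E))%E.
    apply: eq_integral => y _; rewrite /f /= -EFinM /Gamma_fun; congr EFin.
    rewrite mulrACA -expRD [RHS]mulrC; congr (_ * expR _); lra.
  rewrite ge0_integralZl//.
  - rewrite -/(I a b x) I_scale /Gamma_fun EFinM.
    by rewrite muleCA [RHS]muleC -muleA.
  - apply/measurable_EFinP/measurable_funM; last exact: measurable_ppow.
    apply: (measurableT_comp (measurable_ppow _)).
    by apply: measurable_funB => //; exact: measurable_cst.
  - by move=> y _; rewrite lee_fin mulr_ge0 ?ppow_ge0.
  - exact: mG.
have E2 : (\int[mu]_y \int[mu]_x f (x, y) = (Gamma a * Gamma b)%:E)%E.
  rewrite EFinM -(integral_Gamma_fun b0) -ge0_integralZl//; last 2 first.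
  - exact: mG.
  - by rewrite lee_fin ltW// Gamma_gt0.
  apply: eq_integral => y _; rewrite /f /=.
  under eq_integral do rewrite EFinM.
  rewrite ge0_integralZr//.
  - by rewrite (ge0_integral_translate y (mG a) (G0 a)) integral_Gamma_fun.
  - apply: (measurableT_comp (mG a)).
    by apply: measurable_funB => //; exact: measurable_cst.
have : (I a b 1 * (Gamma (a + b))%:E = (Gamma a * Gamma b)%:E)%E.
  by rewrite -E1 -E2 fubini_tonelli.
(* A priori [I a b 1] could be infinite; its finite product with Gamma(a+b) > 0 excludes this. *)
have := I_ge0 a b 1; have Gab := Gamma_gt0 ab0.
case: (I a b 1) => [r _|_|//].
  by rewrite -EFinM => -[<-]; rewrite mulfK// gt_eqF.
by rewrite gt0_mulye ?lte_fin.
Qed.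

End beta.

(** * The heat kernel *)

(** By induction: the measure in dimension n + 1 is the image of a product measure under
    [cons_tuple], so Tonelli splits off the first coordinate. *)
Lemma ge0_integral_tuple_prod (R : realType) n (phi : 'I_n -> R -> R) :
  (forall i, measurable_fun setT (phi i)) -> (forall i x, 0 <= phi i x) ->
  (\int[lebesgue_tuple R n]_x (\prod_(i < n) phi i (tnth x i))%:E =
   \prod_(i < n) \int[@lebesgue_measure R]_x (phi i x)%:E)%E.
Proof.
elim: n phi => [|n IH] phi mphi phi0.
  under eq_integral do rewrite big_ord0.
  by rewrite integral_cst// mul1e big_ord0 /=; exact: diracT.
have mP m (psi : 'I_m -> R -> R) : (forall i, measurable_fun setT (psi i)) ->
    measurable_fun setT (fun x : m.-tuple (measurableTypeR R) =>
      (\prod_(i < m) psi i (tnth x i))%:E).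
  move=> mpsi; apply/measurable_EFinP; apply: measurable_prod => i _.
  by apply: (measurableT_comp (mpsi i)); exact: measurable_tnth.
have P0 m (psi : 'I_m -> R -> R) (x : m.-tuple R) : (forall i x, 0 <= psi i x) ->
    (0 <= (\prod_(i < m) psi i (tnth x i))%:E :> \bar R)%E.
  by move=> psi0; rewrite lee_fin prodr_ge0.
rewrite big_ord_recl -IH//.
pose f (z : measurableTypeR R * n.-tuple (measurableTypeR R)) : \bar R :=
  ((phi ord0 z.1)%:E * (\prod_(i < n) phi (lift ord0 i) (tnth z.2 i))%:E)%E.
transitivity (\int[lebesgue_measure \x lebesgue_tuple R n]_z f z)%E.
  rewrite /= /lebesgue_cons ge0_integral_pushforward//=; last 3 first.
  - exact: measurable_cons_tuple.
  - exact: mP.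
  - by move=> y _; exact: (P0 n.+1 phi).
  rewrite preimage_setT; apply: eq_integral => -[x t] _.
  rewrite /f /= -EFinM big_ord_recl; congr (_%:E)%E; congr (_ * _).
  by apply: eq_bigr => i _; rewrite tnthS.
have mf : measurable_fun setT f.
  apply: emeasurable_funM.
    by apply/measurable_EFinP; apply: (measurableT_comp (mphi ord0)).
  exact: (measurableT_comp (mP n (fun i => phi (lift ord0 i)) (fun i => mphi _)) measurable_snd).
have f0 z : (0 <= f z)%E.
  by apply: mule_ge0; [rewrite lee_fin phi0|exact: (P0 n (fun i => phi (lift ord0 i)))].
rewrite fubini_tonelli1//.
transitivity (\int[lebesgue_measure]_x ((phi ord0 x)%:E *
   \int[lebesgue_tuple R n]_t (\prod_(i < n) phi (lift ord0 i) (tnth t i))%:E))%E.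
  apply: eq_integral => x _; rewrite /fubini_F /f /= ge0_integralZl//.
  - exact: (mP n (fun i => phi (lift ord0 i)) (fun i => mphi _)).
  - by move=> y _; exact: (P0 n (fun i => phi (lift ord0 i))).
  - by rewrite lee_fin phi0.
rewrite ge0_integralZr//.
- by apply/measurable_EFinP; exact: mphi.
- by move=> x _; rewrite lee_fin phi0.
- by apply: integral_ge0 => y _; exact: (P0 n (fun i => phi (lift ord0 i))).
Qed.

Section kernel.
Context {R : realType} {n : nat}.
Local Notation mu := (spacetime_measure R n).
Implicit Types (z w : spacetime R n) (alpha : R).

Definition heat_ker alpha z w : R :=
  heat_kernel alpha [tuple (tnth z.1 i : R) - tnth w.1 i | i < n] (z.2 - w.2).

(** In each space coordinate the kernel is a Gaussian density of variance 2 (t - tau), so space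
    integrals equal 1 and only the factor in time survives. *)
Lemma heat_ker_normal alpha z w : heat_ker alpha z w =
  ppow (alpha - 1) (z.2 - w.2) / Gamma alpha *
  \prod_(i < n) normal_pdf (tnth w.1 i : R) (Num.sqrt (2 * (z.2 - w.2))) (tnth z.1 i).
Proof.
rewrite /heat_ker /heat_kernel /ppow; case: ifPn => [|_]; last by rewrite !mul0r.
set s : R := z.2 - w.2 => s0.
have sq0 : Num.sqrt (2 * s) != 0 by rewrite gt_eqF// sqrtr_gt0 mulr_gt0.
rewrite -mulrA; congr (_ * _).
under [RHS]eq_bigr do rewrite normal_pdfE//.
rewrite big_split/= prodr_const card_ord /normal_peak /normal_fun -expR_sum.
rewrite sqr_sqrtr; last by rewrite mulr_ge0// ltW.
congr (_ * expR _).
  rewrite exprVn; congr (_^-1).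
  rewrite (_ : n%:R / 2 = 2^-1 * n%:R :> R) 1?mulrC// powRrM powR_mulrn ?powR_ge0//.
  rewrite powR12_sqrt; last by rewrite !mulr_ge0 ?pi_ge0// ltW.
  congr (Num.sqrt _ ^+ _); rewrite -mulr_natr; lra.
rewrite -mulr_suml sumrN !mulNr; congr (- (_ / _)).
  by apply: eq_bigr => i _; rewrite tnth_mktuple.
rewrite -mulr_natr; lra.
Qed.

Lemma heat_ker_ge0 alpha z w : 0 < alpha -> 0 <= heat_ker alpha z w.
Proof.
move=> a0; rewrite heat_ker_normal mulr_ge0// ?divr_ge0 ?ppow_ge0 ?(ltW (Gamma_gt0 _))//.
by apply: prodr_ge0 => i _; exact: normal_pdf_ge0.
Qed.

Lemma heat_ker_future alpha z w : (z.2 : R) <= w.2 -> heat_ker alpha z w = 0.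
Proof.
by move=> zw; rewrite /heat_ker /heat_kernel subr_gt0 ltNge zw.
Qed.

Lemma measurable_heat_ker alpha :
  measurable_fun setT (fun zw : spacetime R n * spacetime R n => heat_ker alpha zw.1 zw.2).
Proof.
pose s (zw : spacetime R n * spacetime R n) : R := zw.1.2 - zw.2.2.
have ms : measurable_fun setT s.
  by apply: measurable_funB; apply: measurableT_comp.
(* Writing 1 / s as [ppow (-1)] gives a product of measurable functions without case distinction;
   for s <= 0 the first factor is 0. *)
rewrite (_ : (fun _ => _) = fun zw => ppow (alpha - 1) (s zw) / Gamma alpha *
   (4 * pi * s zw) `^ (- (n%:R / 2)) *
   expR (- (\sum_(i < n) ((tnth zw.1.1 i : R) - tnth zw.2.1 i) ^+ 2) *
   (4^-1 * ppow (-1) (s zw)))); last first.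
  apply/funext => zw; rewrite /heat_ker /heat_kernel -/(s zw).
  have [s0|s0] := ltP 0 (s zw); last by rewrite ppow_le0// !mul0r.
  have -> : 4^-1 * ppow (-1) (s zw) = (4 * s zw)^-1.
    by rewrite ppow_gt0// powR_inv1 ?(ltW s0)// invfM.
  rewrite (ppow_gt0 _ s0) powRN.
  by under eq_bigr do rewrite tnth_mktuple.
apply: measurable_funM.
  apply: measurable_funM.
    apply: measurable_funM; last exact: measurable_cst.
    exact: (measurableT_comp (measurable_ppow _)).
  apply: (measurableT_comp (measurable_powR _)).
  by apply: measurable_funM; first exact: measurable_cst.
apply: (measurableT_comp (@measurable_expR R)).
apply: measurable_funM.
  apply: measurable_funN; apply: measurable_sum => i.
  apply: measurable_funX; apply: measurable_funB.
    by apply: (measurableT_comp (measurable_tnth i)); apply: measurableT_comp.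
  by apply: (measurableT_comp (measurable_tnth i)); apply: measurableT_comp.
apply: measurable_funM; first exact: measurable_cst.
exact: (measurableT_comp (measurable_ppow _)).
Qed.

Let normal_pdf_sym (m s x : R) : s != 0 -> normal_pdf m s x = normal_pdf x s m.
Proof. by move=> s0; rewrite !normal_pdfE// /normal_fun -sqrrN opprB. Qed.

Let gauss_mass (s : R) (y : n.-tuple R) :
  (\int[lebesgue_tuple R n]_x (\prod_(i < n) normal_pdf (tnth y i) s (tnth x i))%:E = 1)%E.
Proof.
rewrite (ge0_integral_tuple_prod (phi := fun i => normal_pdf (tnth y i) s)).
- by rewrite big1// => i _; exact: integral_normal_pdf.
- by move=> i; exact: measurable_normal_pdf.
- by move=> i x; exact: normal_pdf_ge0.
Qed.

Let spacetime_tonelli (f : spacetime R n -> \bar R) :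
  measurable_fun setT f -> (forall z, (0 <= f z)%E) ->
  (\int[mu]_z f z =
   \int[@lebesgue_measure R]_t \int[lebesgue_tuple R n]_x f (x, t))%E.
Proof.
move=> mf f0.
exact: (@fubini_tonelli2 _ _ _ _ R (lebesgue_tuple R n) (@lebesgue_measure R) f mf f0).
Qed.

(** By Tonelli and the unit mass of the Gaussians, the kernel acts on functions of time alone as
    fractional integration of order alpha. *)
Lemma integral_heat_ker_past alpha z (psi : R -> R) : 0 < alpha ->
  measurable_fun setT psi -> (forall t, 0 <= psi t) ->
  (\int[mu]_w (heat_ker alpha z w * psi w.2)%:E =
   \int[@lebesgue_measure R]_t (ppow (alpha - 1) (z.2 - t) / Gamma alpha * psi t)%:E)%E.
Proof.
move=> a0 mpsi psi0; rewrite spacetime_tonelli; last 2 first.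
- apply/measurable_EFinP/measurable_funM; last exact: measurableT_comp.
  exact: (measurableT_comp (measurable_heat_ker alpha) (pair1_measurable z)).
- by move=> w; rewrite lee_fin mulr_ge0// heat_ker_ge0.
apply: eq_integral => t _.
have [tz|tz] := leP (z.2 : R) t.
  rewrite ppow_le0 ?subr_le0// !mul0r integral0_eq// => x _.
  by rewrite heat_ker_future// mul0r.
have s0 : Num.sqrt (2 * (z.2 - t)) != 0.
  by rewrite gt_eqF// sqrtr_gt0 mulr_gt0// subr_gt0.
(* The variable of integration is here the mean of the Gaussian; symmetry exchanges it with the
   point of evaluation. *)
under eq_integral => x _.
  rewrite heat_ker_normal/= mulrAC EFinM.
  under eq_bigr do rewrite normal_pdf_sym//.
  over.
rewrite ge0_integralZl//.
- by rewrite gauss_mass// mule1.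
- apply/measurable_EFinP; apply: measurable_prod => i _.
  apply: (measurableT_comp (measurable_normal_pdf _ _)).
  exact: measurable_tnth.
- by move=> x _; rewrite lee_fin prodr_ge0// => i _; exact: normal_pdf_ge0.
- by rewrite lee_fin mulr_ge0// divr_ge0 ?ppow_ge0// ltW// Gamma_gt0.
Qed.

Lemma integral_heat_ker_future alpha w (psi : R -> R) : 0 < alpha ->
  measurable_fun setT psi -> (forall t, 0 <= psi t) ->
  (\int[mu]_z (heat_ker alpha z w * psi z.2)%:E =
   \int[@lebesgue_measure R]_t (ppow (alpha - 1) (t - w.2) / Gamma alpha * psi t)%:E)%E.
Proof.
move=> a0 mpsi psi0; rewrite spacetime_tonelli; last 2 first.
- apply/measurable_EFinP/measurable_funM; last exact: measurableT_comp.
  exact: (measurableT_comp (measurable_heat_ker alpha) (pair2_measurable w)).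
- by move=> z; rewrite lee_fin mulr_ge0// heat_ker_ge0.
apply: eq_integral => t _.
under eq_integral do rewrite heat_ker_normal/= mulrAC EFinM.
rewrite ge0_integralZl//.
- by rewrite gauss_mass// mule1.
- apply/measurable_EFinP; apply: measurable_prod => i _.
  apply: (measurableT_comp (measurable_normal_pdf _ _)).
  exact: measurable_tnth.
- by move=> x _; rewrite lee_fin prodr_ge0// => i _; exact: normal_pdf_ge0.
- by rewrite lee_fin mulr_ge0// divr_ge0 ?ppow_ge0// ltW// Gamma_gt0.
Qed.

End kernel.

(** * The potential J_alpha on a slab *)

Section potential.
Context {R : realType} {n : nat}.
Local Notation mu := (spacetime_measure R n).
Implicit Types (z w : spacetime R n) (alpha : R) (f g h u v : spacetime R n -> R).

Lemma J_heatE alpha f z :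
  J_heat alpha f z = (\int[mu]_w (heat_ker alpha z w * f w)%:E)%E.
Proof.
rewrite /J_heat integral_mkcond; apply: eq_integral => w _.
rewrite patchE; case: ifPn => // /negP zw.
rewrite heat_ker_future ?mul0r//= leNgt; apply/negP => wz; apply: zw.
by rewrite inE.
Qed.

Lemma measurable_heat_kerl alpha f z : measurable_fun setT f ->
  measurable_fun setT (fun w => (heat_ker alpha z w * f w)%:E).
Proof.
move=> mf; apply/measurable_EFinP/measurable_funM => //.
exact: (measurableT_comp (measurable_heat_ker alpha) (pair1_measurable z)).
Qed.

Lemma ae_eq_J_heat alpha f g z : measurable_fun setT f -> measurable_fun setT g ->
  f = g %[ae mu] -> J_heat alpha f z = J_heat alpha g z.
Proof.
move=> mf mg fg; rewrite !J_heatE; apply: ae_eq_integral => //.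
- exact: measurable_heat_kerl.
- exact: measurable_heat_kerl.
- by apply: filterS fg => w /= fgw _; rewrite fgw.
Qed.

Lemma le_J_heat alpha f g z : 0 < alpha ->
  measurable_fun setT f -> measurable_fun setT g ->
  (forall w, 0 <= f w) -> (forall w, 0 <= g w) ->
  (\forall w \ae mu, f w <= g w) -> (J_heat alpha f z <= J_heat alpha g z)%E.
Proof.
move=> a0 mf mg f0 g0 fg; rewrite !J_heatE; apply: ae_ge0_le_integral => //.
- by move=> w _; rewrite lee_fin mulr_ge0// heat_ker_ge0.
- exact: measurable_heat_kerl.
- by move=> w _; rewrite lee_fin mulr_ge0// heat_ker_ge0.
- exact: measurable_heat_kerl.
- by apply: filterS fg => w /= fgw _; rewrite lee_fin ler_wpM2l// heat_ker_ge0.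
Qed.

Lemma J_heat_ge0 alpha f z : 0 < alpha -> (forall w, 0 <= f w) ->
  (0 <= J_heat alpha f z)%E.
Proof.
move=> a0 f0; rewrite J_heatE; apply: integral_ge0 => w _.
by rewrite lee_fin mulr_ge0// heat_ker_ge0.
Qed.

Let measurable_heat_ker_mul alpha f : measurable_fun setT f ->
  measurable_fun setT (fun zw : spacetime R n * spacetime R n =>
    (heat_ker alpha zw.1 zw.2 * f zw.2)%:E).
Proof.
move=> mf; apply/measurable_EFinP/measurable_funM; first exact: measurable_heat_ker.
exact: measurableT_comp.
Qed.

Lemma measurable_J_heat alpha f : 0 < alpha ->
  measurable_fun setT f -> (forall w, 0 <= f w) ->
  measurable_fun setT (J_heat alpha f).
Proof.
move=> a0 mf f0.
rewrite (_ : J_heat alpha f =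
    fun z => \int[mu]_w (heat_ker alpha z w * f w)%:E)%E; last first.
  by apply/funext => z; rewrite J_heatE.
apply: (measurable_fun_fubini_tonelli_F (m2 := mu)
  (fun zw : spacetime R n * spacetime R n => (heat_ker alpha zw.1 zw.2 * f zw.2)%:E)).
- exact: measurable_heat_ker_mul.
- by move=> zw; rewrite lee_fin mulr_ge0// heat_ker_ge0.
Qed.

(** A Beta integral with exponents alpha and gamma + 1, in which Gamma(alpha) cancels. *)
Lemma J_heat_ppow alpha (c gamma : R) z : 0 < alpha -> 0 <= gamma -> 0 <= c ->
  J_heat alpha (fun w => c * ppow gamma w.2) z =
  (c * (Gamma (gamma + 1) / Gamma (alpha + gamma + 1)) * ppow (alpha + gamma) z.2)%:E.
Proof.
move=> a0 g0 c0; have ga : 0 < gamma + 1 by lra.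
rewrite J_heatE (integral_heat_ker_past z (psi := fun t => c * ppow gamma t))//; last 2 first.
- by apply: measurable_funM => //; exact: measurable_ppow.
- by move=> t; rewrite mulr_ge0 ?ppow_ge0.
have Ga := Gamma_gt0 a0.
transitivity (\int[@lebesgue_measure R]_t ((c / Gamma alpha)%:E *
    (ppow (alpha - 1) (z.2 - t) * ppow (gamma + 1 - 1) t)%:E))%E.
  apply: eq_integral => t _; rewrite addrK -EFinM; congr EFin.
  lra.
rewrite ge0_integralZl//.
- rewrite integral_ppow_conv// -EFinM addrA addrK; congr EFin.
  have key (x y P : R) : x != 0 -> c / x * (x * y * P) = c * y * P.
    by move=> xn; rewrite -!mulrA mulKf// mulrA.
  by rewrite -[Gamma alpha * _ / _]mulrA key ?(gt_eqF Ga).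
- apply/measurable_EFinP/measurable_funM; last exact: measurable_ppow.
  apply: (measurableT_comp (measurable_ppow _)).
  by apply: measurable_funB => //; exact: measurable_cst.
- by move=> t _; rewrite lee_fin mulr_ge0 ?ppow_ge0.
- by rewrite lee_fin divr_ge0// ltW.
Qed.

(** Equal to 1 / Gamma(alpha + 1); times T^alpha it is the potential at time T of the indicator of t
    > 0. *)
Definition heat_mass alpha : R := Gamma 1 / Gamma (alpha + 1).

Lemma heat_mass_gt0 alpha : 0 < alpha -> 0 < heat_mass alpha.
Proof. by move=> a0; rewrite divr_gt0// Gamma_gt0// addr_gt0. Qed.

(** The choice m = (x / A)^(1/s) makes the two terms equal, which leaves y <= 2 m A. *)
Lemma powR_le_optimized (x y A s : R) : 0 <= x -> 0 <= y -> 0 < A -> 1 <= s ->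
  (forall m, 0 < m -> y <= m * A + m `^ (1 - s) * x) ->
  y `^ s <= 2 `^ s * A `^ (s - 1) * x.
Proof.
move=> x0 y0 A0 s1 H; have s0 : 0 < s by lra.
have sn0 : s != 0 by rewrite gt_eqF.
have [xe|xn] := eqVneq x 0.
  (* For x = 0 that choice is not positive; m = y / (2 A) gives y <= y / 2 instead. *)
  have -> : y = 0.
    apply/eqP; rewrite eq_le y0 andbT leNgt; apply/negP => yp.
    have := H (y / (2 * A)) ltac:(by rewrite divr_gt0// mulr_gt0).
    rewrite xe mulr0 addr0 invfM mulrA mulfVK ?gt_eqF//; lra.
  by rewrite powR0// xe mulr0.
have xp : 0 < x by rewrite lt0r xn.
pose m := (x / A) `^ s^-1.
have xA : 0 < x / A by rewrite divr_gt0.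
have m0 : 0 < m by rewrite powR_gt0.
have ms : m `^ s = x / A by rewrite -powRrM mulVf// powRr1// ltW.
have := H m m0.
have -> : m `^ (1 - s) * x = m * A.
  rewrite powRB ?(gt_eqF m0) ?implybT// ms powRr1 ?(ltW m0)// invf_div -mulrA; congr (_ * _).
  by rewrite mulfVK// gt_eqF.
rewrite (_ : m * A + m * A = 2 * (m * A)); last by lra.
move=> yle.
have mA0 : 0 <= m * A by rewrite mulr_ge0// ltW.
apply: (le_trans (ge0_ler_powR (ltW s0) _ _ yle)); rewrite ?nnegrE ?mulr_ge0 ?(ltW m0) ?(ltW A0)//.
rewrite powRM ?(ltW m0) ?(ltW A0)// powRM ?(ltW m0) ?(ltW A0)// ms.
rewrite -!mulrA ler_pM2l ?powR_gt0// powRB ?(gt_eqF A0) ?implybT// powRr1 ?(ltW A0)//.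
lra.
Qed.

End potential.

Section slab.
Context {R : realType} {n : nat}.
Local Notation mu := (spacetime_measure R n).
Implicit Types (z w : spacetime R n) (alpha s T : R) (f g h u v : spacetime R n -> R).

Lemma measurable_powR_comp f s : measurable_fun setT f ->
  measurable_fun setT (fun z => f z `^ s).
Proof. by move=> mf; exact: (measurableT_comp (measurable_powR s)). Qed.

Lemma J_heatD alpha f g z : 0 < alpha ->
  measurable_fun setT f -> measurable_fun setT g ->
  (forall w, 0 <= f w) -> (forall w, 0 <= g w) ->
  (J_heat alpha (fun w => f w + g w)%R z = J_heat alpha f z + J_heat alpha g z)%E.
Proof.
move=> a0 mf mg f0 g0; rewrite !J_heatE.
under eq_integral do rewrite mulrDr EFinD.
rewrite ge0_integralD//; try exact: measurable_heat_kerl;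
  by move=> w _; rewrite lee_fin mulr_ge0// heat_ker_ge0.
Qed.

Lemma J_heatZ alpha (c : R) f z : 0 < alpha -> 0 <= c ->
  measurable_fun setT f -> (forall w, 0 <= f w) ->
  (J_heat alpha (fun w => c * f w)%R z = c%:E * J_heat alpha f z)%E.
Proof.
move=> a0 c0 mf f0; rewrite !J_heatE.
under eq_integral do rewrite mulrCA EFinM.
rewrite ge0_integralZl//; first exact: measurable_heat_kerl.
by move=> w _; rewrite lee_fin mulr_ge0// heat_ker_ge0.
Qed.

(* Jensen's inequality up to a constant: integrate h <= m + m^(1-s) h^s against
   the kernel and optimize in m. *)
Lemma J_heat_powR alpha s T h z (y : R) : 0 < alpha -> 1 <= s ->
  measurable_fun setT h -> (forall w, 0 <= h w) ->
  (forall w, (w.2 : R) <= 0 -> h w = 0) -> 0 < T -> (z.2 : R) < T ->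
  0 <= y -> (y%:E <= J_heat alpha h z)%E ->
  ((y `^ s)%:E <= (2 `^ s * (heat_mass alpha * T `^ alpha) `^ (s - 1))%:E *
     J_heat alpha (fun w => (h w `^ s)%R) z)%E.
Proof.
move=> a0 s1 mh h0 hpast T0 zT y0 yJ; set A := heat_mass alpha * T `^ alpha.
have A0 : 0 < A by rewrite mulr_gt0 ?powR_gt0// heat_mass_gt0.
have c0 : 0 < 2 `^ s * A `^ (s - 1) by rewrite mulr_gt0 ?powR_gt0.
have mhs := measurable_powR_comp s mh.
have hs0 w : 0 <= h w `^ s by exact: powR_ge0.
have m0 (m : R) : measurable_fun setT (fun w : spacetime R n => m * ppow 0 w.2).
  apply: measurable_funM; first exact: measurable_cst.
  exact: (measurableT_comp (measurable_ppow 0)).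
have := J_heat_ge0 z a0 hs0.
case E : (J_heat alpha (fun w => h w `^ s) z) => [x||] //; last first.
  by move=> _; rewrite gt0_muley ?leey // lte_fin.
rewrite lee_fin -EFinM lee_fin => x0; apply: powR_le_optimized => // m mp.
rewrite -lee_fin; apply: (le_trans yJ).
(* The constant m is cut off to t > 0, where [h] lives; its potential would be infinite
   otherwise. *)
apply: (@le_trans _ _ (J_heat alpha (fun w => m * ppow 0 w.2 + m `^ (1 - s) * h w `^ s)%R z)).
  apply: le_J_heat => //.
  - by apply: measurable_funD => //; apply: measurable_funM.
  - by move=> w; rewrite addr_ge0 ?mulr_ge0 ?powR_ge0 ?ppow_ge0 ?ltW.
  apply: aeW => w; have [w0|w0] := leP (w.2 : R) 0.
    by rewrite hpast// powR0 ?mulr0 ?addr0 ?mulr_ge0 ?ppow_ge0 ?(ltW mp)//; lra.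
  rewrite ppow0 w0 mulr1; have [hm|mh'] := leP (h w) m.
    by rewrite (le_trans hm)// lerDl mulr_ge0 ?powR_ge0.
  have hw0 : 0 < h w by exact: lt_trans mh'.
  suff hs : h w <= m `^ (1 - s) * h w `^ s by rewrite (le_trans hs)// lerDr ltW.
  have {1}-> : h w = h w `^ (1 - s) * h w `^ s.
    by rewrite -powRD ?(gt_eqF hw0) ?implybT// subrK powRr1// ltW.
  rewrite ler_pM2r ?powR_gt0//.
  rewrite -[1 - s]opprB !powRN lef_pV2 ?posrE ?powR_gt0//.
  by apply: ge0_ler_powR; rewrite ?nnegrE ?subr_ge0 ?(ltW mp) ?(ltW hw0) ?(ltW mh').
rewrite J_heatD//; last 3 first.
- by apply: measurable_funM.
- by move=> w; rewrite mulr_ge0 ?ppow_ge0 ?ltW.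
- by move=> w; rewrite mulr_ge0 ?powR_ge0.
rewrite J_heatZ ?powR_ge0// E -EFinM EFinD leeD//.
rewrite J_heat_ppow// ?(ltW mp)// lee_fin add0r !addr0 -mulrA ler_pM2l//.
rewrite /A ler_pM2l ?heat_mass_gt0// /ppow; case: ifPn => [z0|_]; last exact: powR_ge0.
by apply: ge0_ler_powR; rewrite ?nnegrE ?ltW.
Qed.

(** For f >= 0, the s-th power of the L^s norm on t < T, kept without the root so that the exponent
    can vary along an iteration. *)
Definition slab_pow T s f : \bar R :=
  (\int[mu]_z ((z.2 < T)%R%:R * f z `^ s)%:E)%E.

Lemma measurable_slab T : measurable_fun setT (fun t : R => (t < T)%R%:R : R).
Proof.
rewrite (_ : (fun _ => _) = fun t => if t < T then 1 else 0); last first.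
  by apply/funext => t; case: ifP.
by apply: measurable_fun_ifT => //; apply: measurable_fun_ltr.
Qed.

Lemma measurable_slab_pow T s f : measurable_fun setT f ->
  measurable_fun setT (fun z : spacetime R n => ((z.2 < T)%R%:R * f z `^ s)%:E).
Proof.
move=> mf; apply/measurable_EFinP/measurable_funM; last exact: measurable_powR_comp.
exact: (measurableT_comp (measurable_slab T)).
Qed.

Lemma le_slab_pow T s f g : 0 <= s -> measurable_fun setT f -> measurable_fun setT g ->
  (\forall z \ae mu, 0 <= f z <= g z) ->
  (slab_pow T s f <= slab_pow T s g)%E.
Proof.
move=> s0 mf mg fg; apply: ae_ge0_le_integral => //.
- by move=> z _; rewrite lee_fin mulr_ge0 ?powR_ge0.
- exact: measurable_slab_pow.
- by move=> z _; rewrite lee_fin mulr_ge0 ?powR_ge0.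
- exact: measurable_slab_pow.
apply: filterS fg => z /= /andP[f0 fgz] _; rewrite lee_fin ler_wpM2l//.
by apply: ge0_ler_powR; rewrite ?nnegrE// (le_trans f0).
Qed.

(** By Tonelli, a source at time tau contributes the mass of the kernel over tau < t < T, namely (T
    - tau)^alpha / Gamma(alpha + 1); sources live at tau > 0, so T^alpha bounds the power. *)
Lemma integral_slab_J_heat alpha T h : 0 < alpha -> 0 < T ->
  measurable_fun setT h -> (forall w, 0 <= h w) ->
  (forall w, (w.2 : R) <= 0 -> h w = 0) ->
  (\int[mu]_z ((z.2 < T)%R%:R%:E * J_heat alpha h z) <=
   (heat_mass alpha * T `^ alpha)%:E * \int[mu]_z ((z.2 < T)%R%:R * h z)%:E)%E.
Proof.
move=> a0 T0 mh h0 hpast.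
have A0 : 0 < heat_mass alpha * T `^ alpha by rewrite mulr_gt0 ?powR_gt0// heat_mass_gt0.
pose F (zw : spacetime R n * spacetime R n) : \bar R :=
  ((zw.1.2 < T)%R%:R * (heat_ker alpha zw.1 zw.2 * h zw.2))%:E.
have mF : measurable_fun setT F.
  apply/measurable_EFinP/measurable_funM.
    by apply: (measurableT_comp (measurable_slab T)); apply: measurableT_comp.
  apply: measurable_funM; first exact: measurable_heat_ker.
  exact: measurableT_comp.
have F0 zw : (0 <= F zw)%E by rewrite lee_fin !mulr_ge0// heat_ker_ge0.
rewrite [leLHS](_ : _ = \int[mu]_z \int[mu]_w F (z, w))%E; last first.
  apply: eq_integral => z _; rewrite J_heatE -ge0_integralZl//.
  - exact: measurable_heat_kerl.
  - by move=> w _; rewrite lee_fin mulr_ge0// heat_ker_ge0.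
rewrite (fubini_tonelli (m1 := mu) (m2 := mu) F mF F0).
rewrite -ge0_integralZl//; last 3 first.
- apply/measurable_EFinP/measurable_funM => //.
  exact: (measurableT_comp (measurable_slab T)).
- by move=> w _; rewrite lee_fin mulr_ge0.
- by rewrite lee_fin ltW.
apply: ge0_le_integral => //.
- by move=> w _; exact: integral_ge0.
- exact: (measurable_fun_fubini_tonelli_G (m1 := mu) F mF F0).
- apply: measurable_funeM; apply/measurable_EFinP/measurable_funM => //.
  exact: (measurableT_comp (measurable_slab T)).
move=> w _; have [w0|w0] := leP (w.2 : R) 0.
  rewrite hpast// mulr0 mule0 integral0_eq// => z _.
  by rewrite /F /= hpast// !mulr0.
have mker : measurable_fun setT (fun z => (heat_ker alpha z w * (z.2 < T)%R%:R)%:E).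
  apply/measurable_EFinP/measurable_funM.
    exact: (measurableT_comp (measurable_heat_ker alpha) (pair2_measurable w)).
  exact: (measurableT_comp (measurable_slab T)).
rewrite (_ : (\int[mu]_z F (z, w) =
    (h w)%:E * \int[mu]_z (heat_ker alpha z w * (z.2 < T)%R%:R)%:E)%E); last first.
  rewrite -ge0_integralZl//.
  - by apply: eq_integral => z _; rewrite /F/= -EFinM; congr EFin; lra.
  - by move=> z _; rewrite lee_fin mulr_ge0// heat_ker_ge0.
  - by rewrite lee_fin.
rewrite [X in (_ * X <= _)%E](_ : _ = \int[@lebesgue_measure R]_t
    (ppow (alpha - 1) (t - w.2) / Gamma alpha * (t < T)%R%:R)%:E)%E; last first.
  exact: (integral_heat_ker_future w a0 (measurable_slab T) (fun t => ler0n R (t < T)%R)).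
have Ga := Gamma_gt0 a0.
(* The reflection t -> T - t turns the indicator of t < T into [ppow 0], and the mass into a Beta
   integral with b = 1. *)
rewrite (ge0_integral_reflect T); last 2 first.
- apply/measurable_EFinP/measurable_funM; last exact: measurable_slab.
  apply: measurable_funM; last exact: measurable_cst.
  apply: (measurableT_comp (measurable_ppow _)).
  by apply: measurable_funB => //; exact: measurable_cst.
- by move=> t; rewrite lee_fin mulr_ge0// divr_ge0 ?ppow_ge0// ltW.
rewrite [X in (_ * X <= _)%E](_ : _ = (heat_mass alpha * ppow alpha (T - w.2))%:E); last first.
  transitivity (\int[@lebesgue_measure R]_x ((Gamma alpha)^-1%:E *
      (ppow (alpha - 1) (T - w.2 - x) * ppow (1 - 1) x)%:E))%E.
    apply: eq_integral => x _; rewrite -EFinM subrr ppow0; congr EFin.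
    rewrite (_ : (T - x < T) = (0 < x)); last by apply/idP/idP; lra.
    by rewrite [T - x - w.2]addrAC; lra.
  rewrite ge0_integralZl//.
  - rewrite integral_ppow_conv// -EFinM addrK /heat_mass; congr EFin.
    by rewrite !mulrA mulVf ?mul1r ?gt_eqF.
  - apply/measurable_EFinP/measurable_funM; last exact: measurable_ppow.
    apply: (measurableT_comp (measurable_ppow _)).
    by apply: measurable_funB => //; exact: measurable_cst.
  - by move=> t _; rewrite lee_fin mulr_ge0 ?ppow_ge0.
  - by rewrite lee_fin invr_ge0 ltW.
have H : ppow alpha (T - w.2) <= T `^ alpha * (w.2 < T)%R%:R.
  rewrite /ppow subr_gt0; case: ifPn => wT; last by rewrite mulr0.
  rewrite mulr1; apply: ge0_ler_powR; rewrite ?nnegrE ?subr_ge0 ?(ltW wT) ?(ltW T0) ?(ltW a0)//.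
  by rewrite gerBl ltW.
rewrite -!EFinM lee_fin.
have := ler_wpM2l (mulr_ge0 (ltW (heat_mass_gt0 a0)) (h0 w)) H; lra.
Qed.

(** The pointwise bound [J_heat_powR], integrated over the slab, meets the L^1 bound for h^s, whose
    factor A completes A^(s-1) to A^s. *)
Lemma slab_pow_J_heat alpha s T h u : 0 < alpha -> 1 <= s -> 0 < T ->
  measurable_fun setT h -> (forall w, 0 <= h w) ->
  (forall w, (w.2 : R) <= 0 -> h w = 0) ->
  measurable_fun setT u -> (forall w, 0 <= u w) ->
  (\forall z \ae mu, ((u z)%:E <= J_heat alpha h z)%E) ->
  (slab_pow T s u <=
   ((2 * (heat_mass alpha * T `^ alpha)) `^ s)%:E * slab_pow T s h)%E.
Proof.
move=> a0 s1 T0 mh h0 hpast mu' u0 uJ; set A := heat_mass alpha * T `^ alpha.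
have A0 : 0 < A by rewrite mulr_gt0 ?powR_gt0// heat_mass_gt0.
have c0 : 0 <= 2 `^ s * A `^ (s - 1) by rewrite mulr_ge0 ?powR_ge0.
have mhs := measurable_powR_comp s mh.
have hs0 w : 0 <= h w `^ s by exact: powR_ge0.
have mJ := measurable_J_heat a0 mhs hs0.
have J0 z := J_heat_ge0 z a0 hs0.
have mT : measurable_fun setT (fun z : spacetime R n => (z.2 < T)%R%:R%:E : \bar R).
  by apply/measurable_EFinP; exact: (measurableT_comp (measurable_slab T)).
pose G z := ((z.2 < T)%R%:R%:E * J_heat alpha (fun w => (h w `^ s)%R) z)%E.
have G0 z : (0 <= G z)%E by rewrite mule_ge0// lee_fin.
have mG : measurable_fun setT G by exact: emeasurable_funM.
apply: (@le_trans _ _ (\int[mu]_z ((2 `^ s * A `^ (s - 1))%:E * G z))%E).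
  apply: ae_ge0_le_integral => //.
  - by move=> z _; rewrite lee_fin mulr_ge0 ?powR_ge0.
  - exact: measurable_slab_pow.
  - by move=> z _; rewrite mule_ge0.
  - exact: measurable_funeM.
  apply: filterS uJ => z /= uz _; rewrite /G muleCA; have [zT|_] := ltP (z.2 : R) T.
    rewrite mul1e mul1r; exact: (@J_heat_powR alpha s T h z (u z)).
  by rewrite mul0r mul0e.
rewrite ge0_integralZl//.
have hspast w : (w.2 : R) <= 0 -> h w `^ s = 0.
  by move=> w0; rewrite hpast// powR0//; lra.
apply: (le_trans (lee_wpmul2l _ (integral_slab_J_heat a0 T0 mhs hs0 hspast))).
  by rewrite lee_fin.
rewrite -/A muleA -EFinM powRM// ?(ltW A0)//.
rewrite -(mulr_powRB1 (ltW A0) (lt_le_trans ltr01 s1)).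
by rewrite [A * _]mulrC [X in (_ <= X%:E * _)%E]mulrA.
Qed.

End slab.

(** * From L^s to L^infty *)

Section bootstrap.
Context {R : realType} {n : nat}.
Local Notation mu := (spacetime_measure R n).
Implicit Types (z w : spacetime R n) (alpha beta lambda sigma s T : R).
Implicit Types (f g h u v : spacetime R n -> R).

Lemma ae_imp (P Q : spacetime R n -> Prop) : (forall z, P z -> Q z) ->
  (\forall z \ae mu, P z) -> \forall z \ae mu, Q z.
Proof. by move=> PQ; apply: filterS. Qed.

Lemma ae_imp2 (P Q S : spacetime R n -> Prop) : (forall z, P z -> Q z -> S z) ->
  (\forall z \ae mu, P z) -> (\forall z \ae mu, Q z) -> \forall z \ae mu, S z.
Proof. by move=> PQS; apply: filterS2. Qed.

(** Chebyshev: the set where v > (1 + d) E has measure at most K / (1 + d)^s for unboundedly large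
    s, hence is null. *)
Lemma slab_pow_ae_le T v (E K : R) (s_ : nat -> R) :
  measurable_fun setT v -> (forall z, 0 <= v z) -> 0 < E ->
  (forall B : R, exists k, B <= s_ k) ->
  (forall k, 0 <= s_ k) ->
  (forall k, slab_pow T (s_ k) v <= (K * E `^ s_ k)%:E)%E ->
  \forall z \ae mu, (z.2 : R) < T -> v z <= E.
Proof.
move=> mv v0 E0 s_y s_0 H.
pose N (d : R) : set (spacetime R n) :=
  ((fun z : spacetime R n => z.2 : R) @^-1` `]-oo, T[) `&` (v @^-1` `](1 + d) * E, +oo[).
have mN d : measurable (N d).
  apply: measurableI.
    rewrite -[X in measurable X]setTI.
    by apply: (@measurable_snd _ _ (n.-tuple (measurableTypeR R)) (measurableTypeR R)).
  by rewrite -[X in measurable X]setTI; exact: mv.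
have N0 d : 0 < d -> mu (N d) = 0.
  move=> d0; have dE : 0 < (1 + d) * E by rewrite mulr_gt0// addr_gt0.
  pose c : R := ln (1 + d).
  have c0 : 0 < c by rewrite ln_gt0// ltrDl.
  have B k : ((1 + s_ k * c)%:E * mu (N d) <= K%:E)%E.
    have Es : 0 < E `^ s_ k by rewrite powR_gt0.
    have h1 : ((((1 + d) * E) `^ s_ k)%:E * mu (N d) <= (K * E `^ s_ k)%:E)%E.
      apply: le_trans (H k); rewrite -integral_cst// /slab_pow.
      apply: (@le_trans _ _ (\int[mu]_(z in N d) ((z.2 < T)%R%:R * v z `^ s_ k)%:E)%E).
        apply: ge0_le_integral => //.
        - by move=> z _; rewrite lee_fin powR_ge0.
        - by apply: measurable_funTS; exact: measurable_slab_pow.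
        move=> z [/=]; rewrite !in_itv/= andbT => -> dv; rewrite lee_fin mul1r.
        by apply: ge0_ler_powR; rewrite ?nnegrE// ltW.
      apply: ge0_subset_integral => //; first exact: measurable_slab_pow.
      by move=> z _; rewrite lee_fin mulr_ge0 ?powR_ge0.
    rewrite powRM ?(ltW E0)// ?addr_ge0 ?(ltW d0)// in h1.
    have d1 : 1 + s_ k * c <= (1 + d) `^ s_ k.
      rewrite /powR gt_eqF ?addr_gt0//; exact: expR_ge1Dx.
    have : (((1 + d) `^ s_ k)%:E * mu (N d) <= K%:E)%E.
      rewrite -(@lee_pmul2l _ (E `^ s_ k)%:E) ?lte_fin//.
      by rewrite muleA -!EFinM mulrC [X in (_ <= X%:E)%E]mulrC.
    by apply: le_trans; rewrite lee_wpmul2r// lee_fin.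
  have : (0 <= mu (N d))%E by exact: measure_ge0.
  case E' : (mu (N d)) => [m||] //; last first.
    move=> _; have := B 0%N; rewrite E' gt0_muley ?leye_eq// lte_fin.
    by rewrite ltr_pwDl// mulr_ge0// ltW.
  rewrite lee_fin => m0; apply/eqP; rewrite eqe eq_le m0 andbT leNgt; apply/negP => mp.
  have [k kB] := s_y ((`|K| / m) / c).
  have := B k; rewrite E' -EFinM lee_fin leNgt => /negP; apply.
  apply: (le_lt_trans (ler_norm K)); rewrite -ltr_pdivrMr//.
  by rewrite ltr_pwDl// -ler_pdivrMr.
(* The set where v > E is exhausted by d = 1 / (k + 1). *)
have : mu.-negligible (\bigcup_k N k.+1%:R^-1).
  apply: negligible_bigcup => k; apply/negligibleP => //.
  by apply: N0; rewrite invr_gt0.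
apply: negligibleS => z /= /not_implyP[zT /negP]; rewrite -ltNge => Ev.
pose k := Num.bound (v z / E - 1)^-1.
have e0 : 0 < v z / E - 1 by rewrite subr_gt0 ltr_pdivlMr// mul1r.
exists k => //; split; rewrite /= in_itv/= ?zT// andbT.
rewrite -ltr_pdivlMr// addrC -ltrBrDr.
rewrite invf_plt ?posrE//.
have := archi_boundP (_ : 0 <= (v z / E - 1)^-1); rewrite -/k => /(_ ltac:(by rewrite invr_ge0 ltW)).
by move=> /lt_trans; apply; rewrite ltr_nat.
Qed.

(** One half of the system, freed from the function spaces: [f] stands for (d_t - Delta)^alpha u,
    with sign and vanishing in the past imposed at every point. *)
Definition heat_bound alpha lambda u v : Prop :=
  [/\ measurable_fun setT u, forall z, 0 <= u z &
  exists f, [/\ measurable_fun setT f /\ (forall z, 0 <= f z),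
    forall z, (z.2 : R) <= 0 -> f z = 0,
    \forall z \ae mu, f z <= v z `^ lambda &
    \forall z \ae mu, ((u z)%:E <= J_heat alpha f z)%E]].

(** Half a round trip of the bootstrap: f <= v^lambda turns the exponent s for [f] into lambda s for
    [v]. *)
Lemma heat_bound_slab alpha lambda u v s T : 0 < alpha -> 1 <= s -> 0 < T ->
  measurable_fun setT v -> (forall z, 0 <= v z) -> heat_bound alpha lambda u v ->
  (slab_pow T s u <= ((2 * (heat_mass alpha * T `^ alpha)) `^ s)%:E *
     slab_pow T (lambda * s) v)%E.
Proof.
move=> a0 s1 T0 mv v0 [mu' u0 [f [[mf f0] fpast fv uJ]]].
apply: (le_trans (slab_pow_J_heat a0 s1 T0 mf f0 fpast mu' u0 uJ)).
apply: lee_wpmul2l; first by rewrite lee_fin powR_ge0.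
rewrite (_ : slab_pow T (lambda * s) v = slab_pow T s (fun z => v z `^ lambda)).
  apply: le_slab_pow => //; first by lra.
    exact: measurable_powR_comp.
  by apply: filterS fv => z fz; rewrite f0.
by rewrite /slab_pow; apply: eq_integral => z _; rewrite powRrM.
Qed.

(** The comparison function for [f] is again a power of time, on which the potential is explicit;
    the constant is kept exact for the later iteration. *)
Lemma heat_bound_ppow alpha lambda u v (C b : R) :
  0 < alpha -> 0 < lambda -> 0 <= b -> 0 <= C ->
  heat_bound alpha lambda u v ->
  (\forall z \ae mu, v z <= C * ppow b z.2) ->
  (forall z, 0 <= v z) ->
  \forall z \ae mu, u z <= C `^ lambda *
    (Gamma (b * lambda + 1) / Gamma (alpha + b * lambda + 1)) *
    ppow (alpha + b * lambda) z.2.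
Proof.
move=> a0 l0 b0 C0 [mu' u0 [f [[mf f0] fpast fv uJ]]] vC v0.
have bl0 : 0 <= b * lambda by rewrite mulr_ge0// ltW.
have H z : (J_heat alpha f z <=
    J_heat alpha (fun w => C `^ lambda * ppow (b * lambda) w.2)%R z)%E.
  apply: le_J_heat => //.
  - apply: measurable_funM => //.
    exact: (measurableT_comp (measurable_ppow _)).
  - by move=> w; rewrite mulr_ge0 ?powR_ge0 ?ppow_ge0.
  apply: filterS2 fv vC => w fw vw; have [w0|w0] := leP (w.2 : R) 0.
    by rewrite fpast// mulr_ge0 ?powR_ge0 ?ppow_ge0.
  apply: (le_trans fw); rewrite !ppow_gt0// in vw *.
  rewrite powRrM -powRM ?powR_ge0//.
  by apply: ge0_ler_powR; rewrite ?nnegrE ?mulr_ge0 ?powR_ge0 ?(ltW l0).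
apply: filterS uJ => z uz; rewrite -lee_fin (le_trans uz)// (le_trans (H z))//.
by rewrite J_heat_ppow// powR_ge0.
Qed.

(** Here [lambda <= 1] keeps the intermediate exponent s / lambda at least 1, as the Jensen-type
    bound requires. *)
Lemma heat_bound_bootstrap alpha beta lambda sigma (q : R) u v :
  0 < alpha -> 0 < beta -> 0 < lambda -> 0 < sigma -> lambda * sigma < 1 ->
  lambda <= 1 -> 1 <= q ->
  heat_bound alpha lambda u v -> heat_bound beta sigma v u ->
  (forall T, 0 < T -> (slab_pow T q v < +oo)%E) ->
  exists2 C : R, 0 <= C & \forall z \ae mu,
    v z <= C * ppow ((beta + alpha * sigma) / (1 - lambda * sigma)) z.2.
Proof.
move=> a0 b0 l0 s0 ls1 l1 q1 uv vu qfin.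
have [mu' u0 _] := uv; have [mv v0 [g [[mg g0] gpast _ vJ]]] := vu.
set theta := lambda * sigma; have th0 : 0 < theta by rewrite mulr_gt0.
have th1 : 0 < 1 - theta by rewrite subr_gt0.
set b := (_ / _).
pose A T := 2 * (heat_mass alpha * T `^ alpha).
pose B T := 2 * (heat_mass beta * T `^ beta).
have A0 T : 0 < T -> 0 < A T.
  by move=> T0; rewrite mulr_gt0// mulr_gt0 ?powR_gt0// heat_mass_gt0.
have B0 T : 0 < T -> 0 < B T.
  by move=> T0; rewrite mulr_gt0// mulr_gt0 ?powR_gt0// heat_mass_gt0.
pose D T := B T * A T `^ sigma.
have D0 T : 0 < T -> 0 < D T.
  by move=> T0; apply: mulr_gt0; [exact: B0|apply: powR_gt0; exact: A0].
(* [E T] solves D^(s/theta) E^s = E^(s/theta) for every s, so the ratio of [slab_pow] to E^s does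
   not increase along round trips. *)
pose E T := D T `^ (1 - theta)^-1.
have E0 T : 0 < T -> 0 < E T by move=> T0; rewrite powR_gt0// D0.
pose s_ k := q / theta ^+ k.
have thX k : 0 < theta ^+ k by rewrite exprn_gt0.
have s_ge1 k : 1 <= s_ k.
  by rewrite ler_pdivlMr// mul1r (le_trans _ q1)// exprn_ile1// ltW.
have s_S k : s_ k.+1 = s_ k / theta by rewrite /s_ exprSr invfM mulrA.
(* One round trip: exponent s for [v], s / lambda for [u], s / theta for [v]. *)
have step T s : 0 < T -> 1 <= s ->
    (slab_pow T (s / theta) v <= (D T `^ (s / theta))%:E * slab_pow T s v)%E.
  move=> T0 s1.
  have sth : 1 <= s / theta by rewrite ler_pdivlMr// mul1r (le_trans (ltW ls1)).
  have sl : 1 <= s / lambda by rewrite ler_pdivlMr// mul1r (le_trans l1).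
  apply: (le_trans (heat_bound_slab b0 sth T0 mu' u0 vu)).
  have sE : sigma * (s / theta) = s / lambda.
    apply: (@mulIf _ theta); first by rewrite gt_eqF.
    rewrite -mulrA divfK ?gt_eqF// /theta mulrA divfK ?gt_eqF//.
    by rewrite mulrC.
  rewrite sE.
  apply: (le_trans (lee_wpmul2l _ (heat_bound_slab a0 sl T0 mv v0 uv))).
    by rewrite lee_fin powR_ge0.
  rewrite (_ : lambda * (s / lambda) = s); last by rewrite mulrC divfK// gt_eqF.
  have -> : D T `^ (s / theta) = B T `^ (s / theta) * A T `^ (s / lambda).
    by rewrite -sE [A T `^ (sigma * _)]powRrM -powRM ?powR_ge0// ltW// B0.
  by rewrite muleA -EFinM.
have vE T : 0 < T -> \forall z \ae mu, (z.2 : R) < T -> v z <= E T.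
  move=> T0; have := qfin T T0.
  have : (0 <= slab_pow T q v)%E.
    by apply: integral_ge0 => z _; rewrite lee_fin mulr_ge0 ?powR_ge0.
  case K_ : (slab_pow T q v) => [K||] // K0 _.
  (* The ratio at the initial exponent q bounds all later ones. *)
  apply: (@slab_pow_ae_le T v (E T) (K / E T `^ q) s_) => //.
  - exact: E0.
  - move=> M; pose c := ln theta^-1.
    have c0 : 0 < c by rewrite ln_gt0// invf_gt1// -subr_gt0.
    pose k := Num.bound (`|M| / c); exists k.
    have Mk : `|M| <= k%:R * c.
      rewrite -ler_pdivrMr// ltW//; apply: archi_boundP.
      by rewrite divr_ge0// ltW.
    apply: (le_trans (ler_norm M)); apply: (le_trans Mk).
    apply: (@le_trans _ _ (theta ^- k)).
      rewrite -exprVn -[theta^-1]lnK ?posrE ?invr_gt0// -/c -expRM_natl.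
      by apply: le_trans (expR_ge1Dx _); rewrite lerDr.
    by rewrite /s_ ler_peMl// invr_ge0 ltW.
  - by move=> k; rewrite (le_trans ler01).
  elim=> [|k IH].
    by rewrite /s_ expr0 divr1 K_ divfK ?gt_eqF// powR_gt0// E0.
  rewrite s_S; apply: (le_trans (step T _ T0 (s_ge1 k))).
  apply: (le_trans (lee_wpmul2l _ IH)); first by rewrite lee_fin powR_ge0.
  rewrite -EFinM lee_fin mulrCA ler_wpM2l ?divr_ge0 ?powR_ge0//.
  have sE : s_ k / theta + (1 - theta)^-1 * s_ k = (1 - theta)^-1 * (s_ k / theta).
    have -> : (1 - theta)^-1 * s_ k = (1 - theta)^-1 * (s_ k / theta) * theta.
      by rewrite -mulrA divfK// gt_eqF.
    have e1 : (1 - theta) * (1 - theta)^-1 = 1 by rewrite divff// gt_eqF.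
    by rewrite -[X in X + _ = _]mul1r -{1}e1; lra.
  by rewrite /E -!powRrM -powRD ?(gt_eqF (D0 _ T0)) ?implybT// sE.
have b_ge0 : 0 <= b.
  by rewrite divr_ge0 ?(ltW th1)// addr_ge0 ?mulr_ge0 ?(ltW a0) ?(ltW b0) ?(ltW s0).
(* [D T] is homogeneous in T of degree beta + alpha sigma, so [E T] has degree [b]. *)
have ET T : 0 < T -> E T = E 1 * T `^ b.
  move=> T0; have -> : T `^ b = (T `^ beta * (T `^ alpha) `^ sigma) `^ (1 - theta)^-1.
    by rewrite -powRrM -powRD ?(gt_eqF T0) ?implybT// -powRrM.
  have p0 : 0 <= T `^ beta * (T `^ alpha) `^ sigma by rewrite mulr_ge0 ?powR_ge0.
  rewrite /E -powRM ?p0 ?(ltW (D0 _ ltr01))//; congr (_ `^ _).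
  rewrite /D (_ : B T = B 1 * T `^ beta); last by rewrite /B powR1 mulr1 mulrA.
  rewrite (_ : A T = A 1 * T `^ alpha); last by rewrite /A powR1 mulr1 mulrA.
  by rewrite (powRM _ (ltW (A0 _ ltr01)) (powR_ge0 _ _)) mulrACA.
exists (E 1 * 2 `^ b); first by rewrite mulr_ge0 ?powR_ge0.
(* An enumeration of the rationals, so that the bounds for all rational T > 0 hold off one null set;
   indices coding no rational get the harmless value 1. *)
pose r (k : nat) : R := if @unpickle rat k is Some x then ratr x else 1.
have rk k : \forall z \ae mu, 0 < r k -> (z.2 : R) < r k -> v z <= E (r k).
  have [r0|r0] := ltP 0 (r k); last exact: aeW.
  by apply: ae_imp (vE _ r0) => z h _.
have rE : \forall z \ae mu, forall k, 0 < r k -> (z.2 : R) < r k -> v z <= E (r k).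
  exact: ae_foralln.
apply: ae_imp2 rE vJ => z zE zJ; have [z0|z0] := leP (z.2 : R) 0.
  rewrite ppow_le0// mulr0 -lee_fin (le_trans zJ)// J_heatE integral0_eq// => w _.
  have [w0|w0] := leP (w.2 : R) 0; first by rewrite gpast ?mulr0.
  by rewrite heat_ker_future ?mul0r// (le_trans z0)// ltW.
(* A rational x between t and 2 t gives v <= E(x) = E(1) x^b <= E(1) 2^b t^b. *)
have z2 : (z.2 : R) < 2 * z.2 by lra.
have [x /[!in_itv]/= /andP[zx x2z]] := rat_in_itvoo z2.
have rx : r (pickle x) = ratr x by rewrite /r pickleK.
have x0 : 0 < ratr x :> R by exact: lt_trans zx.
have := zE (pickle x); rewrite rx => /(_ x0 zx) vx.
apply: (le_trans vx); rewrite ET// -mulrA ler_wpM2l ?powR_ge0// ppow_gt0//.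
rewrite -powRM// ?(ltW z0)//.
apply: ge0_ler_powR; rewrite ?nnegrE ?(ltW x0) ?(ltW x2z)//.
by rewrite mulr_ge0// ltW.
Qed.

End bootstrap.

(** * The sharp constant *)

Section sharp.
Context {R : realType} {n : nat}.
Local Notation mu := (spacetime_measure R n).
Implicit Types (z w : spacetime R n) (alpha beta lambda sigma s T : R).
Implicit Types (f g h u v : spacetime R n -> R).

(* The self-similar solution is (c t^a, d t^b), with
   b = growth alpha beta lambda sigma and a = growth beta alpha sigma lambda. *)
Definition growth alpha beta lambda sigma : R :=
  (beta + alpha * sigma) / (1 - lambda * sigma).

(** J_alpha sends t^c to this multiple of t^(alpha + c). *)
Definition Gamma_ratio alpha (c : R) : R := Gamma (c + 1) / Gamma (alpha + c + 1).

Lemma Gamma_ratio_gt0 alpha (c : R) : 0 < alpha -> 0 <= c -> 0 < Gamma_ratio alpha c.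
Proof.
move=> a0 c0; rewrite divr_gt0//; apply: Gamma_gt0; first by lra.
by rewrite -addrA addr_gt0//; lra.
Qed.

(** With G1, G2 the two Gamma ratios, this is the positive fixed point of C -> (C^lambda G1)^sigma
    G2, the action of a round trip on constants. *)
Definition sharp_const alpha beta lambda sigma : R :=
  (Gamma_ratio alpha (growth alpha beta lambda sigma * lambda) `^ sigma *
   Gamma_ratio beta (growth beta alpha sigma lambda * sigma))
    `^ (1 - lambda * sigma)^-1.

(** This balance makes a round trip send t^b to a multiple of t^b. *)
Lemma growthE alpha beta lambda sigma : lambda * sigma < 1 ->
  growth alpha beta lambda sigma = beta + growth beta alpha sigma lambda * sigma.
Proof.
move=> ls1; rewrite /growth [sigma * lambda]mulrC.
have e : (1 - lambda * sigma) * (1 - lambda * sigma)^-1 = 1.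
  by rewrite divff// gt_eqF// subr_gt0.
rewrite -[X in _ = X + _]mulr1 -{2}e; lra.
Qed.

Lemma heat_bound_sharp alpha beta lambda sigma u v (C : R) :
  0 < alpha -> 0 < beta -> 0 < lambda -> 0 < sigma -> lambda * sigma < 1 ->
  heat_bound alpha lambda u v -> heat_bound beta sigma v u ->
  (\forall z \ae mu, v z <= C * ppow (growth alpha beta lambda sigma) z.2) ->
  \forall z \ae mu, v z <= sharp_const alpha beta lambda sigma *
    ppow (growth alpha beta lambda sigma) z.2.
Proof.
move=> a0 b0 l0 s0 ls1 uv vu vC.
have [mu' u0 _] := uv; have [mv v0 _] := vu.
have sl1 : sigma * lambda < 1 by rewrite mulrC.
have bE := growthE alpha beta ls1; have aE := growthE beta alpha sl1.
have b_ge0 : 0 <= growth alpha beta lambda sigma.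
  by rewrite divr_ge0 ?subr_ge0 ?addr_ge0 ?mulr_ge0 ?(ltW a0) ?(ltW b0) ?(ltW s0) ?(ltW ls1).
have a_ge0 : 0 <= growth beta alpha sigma lambda.
  by rewrite divr_ge0 ?subr_ge0 ?addr_ge0 ?mulr_ge0 ?(ltW a0) ?(ltW b0) ?(ltW l0) ?(ltW sl1).
have th1 : 0 < 1 - lambda * sigma by rewrite subr_gt0.
have th0 : 0 < lambda * sigma by rewrite mulr_gt0.
have tho : lambda * sigma != 0 by rewrite gt_eqF.
rewrite /sharp_const.
set G1 := Gamma_ratio alpha _; set G2 := Gamma_ratio beta _.
have G10 : 0 < G1 by rewrite Gamma_ratio_gt0// mulr_ge0// ltW.
have G20 : 0 < G2 by rewrite Gamma_ratio_gt0// mulr_ge0// ltW.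
set b := growth alpha _ _ _ in bE b_ge0 vC *.
set a := growth beta _ _ _ in aE bE a_ge0 *.
set L := _ `^ _; set theta := lambda * sigma in ls1 th0 th1 tho L *.
have L0 : 0 < L by rewrite powR_gt0// mulr_gt0// powR_gt0.
have Lpow : L `^ (1 - theta) = G1 `^ sigma * G2.
  have GG : 0 <= G1 `^ sigma * G2 by apply: mulr_ge0; [exact: powR_ge0|exact: ltW].
  by rewrite /L -powRrM mulVf ?(gt_eqF th1)// (powRr1 GG).
(* The initial excess over the sharp constant: C <= L D, and each round trip raises the excess to
   the power theta. *)
pose D := Num.max 1 (C / L).
have D1 : 1 <= D by rewrite le_max lexx.
have D0 : 0 < D by exact: lt_le_trans D1.
have step k : \forall z \ae mu, v z <= L * D `^ (theta ^+ k) * ppow b z.2.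
  elim: k => [|k IH].
    rewrite expr0 powRr1 ?(ltW D0)//; apply: ae_imp vC => z /le_trans; apply.
    by rewrite ler_wpM2r ?ppow_ge0// -ler_pdivrMl// mulrC le_max lexx orbT.
  set c := L * D `^ (theta ^+ k) in IH.
  have c0 : 0 <= c by rewrite mulr_ge0 ?powR_ge0// ltW.
  have uC : \forall z \ae mu, u z <= c `^ lambda * G1 * ppow a z.2.
    by rewrite aE; exact: (heat_bound_ppow a0 l0 b_ge0 c0 uv IH v0).
  have c1 : 0 <= c `^ lambda * G1 by exact: (mulr_ge0 (powR_ge0 _ _) (ltW G10)).
  have vC' : \forall z \ae mu, v z <= (c `^ lambda * G1) `^ sigma * G2 * ppow b z.2.
    by rewrite bE; exact: (heat_bound_ppow b0 s0 a_ge0 c1 vu uC u0).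
  (* By the definition of L the new constant is c^theta L^(1 - theta). *)
  rewrite (_ : L * D `^ (theta ^+ k.+1) = (c `^ lambda * G1) `^ sigma * G2)//.
  apply: esym.
  rewrite powRM ?powR_ge0 ?(ltW G10)// -powRrM -mulrA -Lpow /c.
  rewrite powRM ?powR_ge0 ?(ltW L0)// -powRrM mulrAC -powRD ?(gt_eqF L0) ?implybT//.
  by rewrite addrC subrK powRr1 ?(ltW L0)// exprSr.
(* All rounds hold off a common null set; pointwise, theta^k -> 0 makes the excess tend to 1. *)
have H : \forall z \ae mu, forall k, v z <= L * D `^ (theta ^+ k) * ppow b z.2.
  exact: ae_foralln.
apply: ae_imp H => z Hz.
have cv : (fun k => L * D `^ (theta ^+ k) * ppow b z.2) @ \oo --> L * 1 * ppow b z.2.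
  apply: cvgM; last exact: cvg_cst.
  apply: cvgM; first exact: cvg_cst.
  rewrite (_ : (fun k => _) = (fun k => expR (theta ^+ k * ln D))); last first.
    by apply/funext => k; rewrite /powR gt_eqF.
  rewrite -(@expR0 R); apply: continuous_cvg; first exact: continuous_expR.
  rewrite -[X in _ --> X](mul0r (ln D)); apply: cvgM; last exact: cvg_cst.
  by apply: cvg_expr; rewrite ger0_norm// ltW.
rewrite -[L]mulr1 -(cvg_lim _ cv)//; apply: limr_ge; first by apply/cvg_ex; exists (L * 1 * ppow b z.2).
exact: nearW.
Qed.

(** One use of [heat_bound_ppow] gives [u] a bound with the right exponent; [heat_bound_sharp] then
    applies to [u] with the roles exchanged. *)
Lemma heat_bound_sharp_pair alpha beta lambda sigma u v (C : R) :
  0 < alpha -> 0 < beta -> 0 < lambda -> 0 < sigma -> lambda * sigma < 1 ->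
  heat_bound alpha lambda u v -> heat_bound beta sigma v u -> 0 <= C ->
  (\forall z \ae mu, v z <= C * ppow (growth alpha beta lambda sigma) z.2) ->
  (\forall z \ae mu, u z <= sharp_const beta alpha sigma lambda *
    ppow (growth beta alpha sigma lambda) z.2) /\
  (\forall z \ae mu, v z <= sharp_const alpha beta lambda sigma *
    ppow (growth alpha beta lambda sigma) z.2).
Proof.
move=> a0 b0 l0 s0 ls1 uv vu C0 vC.
have [_ v0 _] := vu.
have sl1 : sigma * lambda < 1 by rewrite mulrC.
have b_ge0 : 0 <= growth alpha beta lambda sigma.
  by rewrite divr_ge0 ?subr_ge0 ?addr_ge0 ?mulr_ge0 ?(ltW a0) ?(ltW b0) ?(ltW s0) ?(ltW ls1).
split; last exact: (heat_bound_sharp a0 b0 l0 s0 ls1 uv vu vC).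
have := heat_bound_ppow a0 l0 b_ge0 C0 uv vC v0.
rewrite -(growthE beta alpha sl1) => uC.
exact: (heat_bound_sharp b0 a0 s0 l0 sl1 vu uv uC).
Qed.

(** As lambda sigma < 1, one exponent is at most 1; the bootstrap starts from [v] if it is lambda
    and from [u] if it is sigma. *)
Lemma heat_bound_sharp_system alpha beta lambda sigma (p q : R) u v :
  0 < alpha -> 0 < beta -> 0 < lambda -> 0 < sigma -> lambda * sigma < 1 ->
  1 <= p -> 1 <= q ->
  heat_bound alpha lambda u v -> heat_bound beta sigma v u ->
  (forall T, 0 < T -> (slab_pow T p u < +oo)%E) ->
  (forall T, 0 < T -> (slab_pow T q v < +oo)%E) ->
  (\forall z \ae mu, u z <= sharp_const beta alpha sigma lambda *
    ppow (growth beta alpha sigma lambda) z.2) /\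
  (\forall z \ae mu, v z <= sharp_const alpha beta lambda sigma *
    ppow (growth alpha beta lambda sigma) z.2).
Proof.
move=> a0 b0 l0 s0 ls1 p1 q1 uv vu up vq.
have sl1 : sigma * lambda < 1 by rewrite mulrC.
have [l1|l1] := leP lambda 1.
  have [C C0 vC] := heat_bound_bootstrap a0 b0 l0 s0 ls1 l1 q1 uv vu vq.
  exact: (heat_bound_sharp_pair a0 b0 l0 s0 ls1 uv vu C0 vC).
have s1 : sigma <= 1.
  rewrite leNgt; apply/negP => s1; have := mulr_egt1 l1 s1; lra.
have [C C0 uC] := heat_bound_bootstrap b0 a0 s0 l0 sl1 s1 p1 vu uv up.
by have [? ?] := heat_bound_sharp_pair b0 a0 s0 l0 sl1 vu uv C0 uC.
Qed.

End sharp.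

(** * The fractional heat operator *)

Section representation.
Context {R : realType} {n : nat}.
Local Notation mu := (spacetime_measure R n).
Implicit Types (z w : spacetime R n) (alpha beta lambda sigma s T p : R).
Implicit Types (f g h u v : spacetime R n -> R).

(** Bridges the gap between data vanishing for t < 0 and [heat_bound], which asks for t <= 0. *)
Lemma ae_time_neq0 : \forall z \ae mu, (z.2 : R) != 0.
Proof.
exists (setT `*` [set 0 : R]); split; first exact: measurableX.
  rewrite /= /spacetime_measure product_measure1E//.
  rewrite [X in (_ * X)%E](_ : _ = 0%E) ?mule0//.
  exact: (@lebesgue_measure_set1 R 0).
by move=> z /= /negP; rewrite negbK => /eqP.
Qed.

Lemma finite_norm_slab_pow p T f g : 0 < p ->
  measurable_fun setT f -> measurable_fun setT g -> f = g %[ae mu] ->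
  (forall z, 0 <= g z) ->
  finite_norm mu p%:E (f \_ [set z | (z.2 : R) < T]) -> (slab_pow T p g < +oo)%E.
Proof.
move=> p0 mf mg fg g0 fin.
have pn0 : p != 0 by rewrite gt_eqF.
have -> : slab_pow T p g =
    (\int[mu]_z `|(f \_ [set z | ((z.2 : R) < T)%R]) z|%:E `^ p)%E.
  have mT : measurable [set z : spacetime R n | (z.2 : R) < T].
    rewrite (_ : [set z | _] = (fun z : spacetime R n => z.2 : R) @^-1` `]-oo, T[); last first.
      by apply/seteqP; split => z /=; rewrite in_itv.
    rewrite -[X in measurable X]setTI.
    by apply: (@measurable_snd _ _ (n.-tuple (measurableTypeR R)) (measurableTypeR R)).
  apply: ge0_ae_eq_integral => //.
  - exact: measurable_slab_pow.
  - apply: (measurableT_comp (measurable_poweR p)).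
    apply/measurable_EFinP; apply: measurableT_comp => //.
    by apply/(measurable_restrictT f) => //; exact: measurable_funTS.
  - by move=> z _; rewrite lee_fin mulr_ge0 ?powR_ge0.
  - by move=> z _; exact: poweR_ge0.
  apply: ae_imp fg => z /= fgz _; rewrite patchE fgz//.
  have [zT|zT] := ltP (z.2 : R) T.
    by rewrite mem_set//= mul1r ger0_norm.
  by rewrite memNset ?normr0 ?powR0 ?mul0r//=; apply/negP; rewrite -leNgt.
rewrite [ltLHS](_ : _ = (\int[mu]_z `|(EFin \o (f \_ [set z | ((z.2 : R) < T)%R])) z| `^ p)%E)//.
by rewrite -poweR_Lnorm// poweR_lty.
Qed.

(** As [u] lies in the range of the potential, [frac_heat] returns a true preimage, which is then
    corrected on a null set. *)
Lemma frac_heat_representation alpha p u v lambda : 0 < alpha -> 0 < lambda -> 0 < p ->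
  u \in Y_space alpha p ->
  (\forall z \ae mu, 0 <= frac_heat alpha p u z <= v z `^ lambda) ->
  (\forall z \ae mu, (z.2 : R) < 0 -> v z = 0) ->
  exists f, [/\ measurable_fun setT f /\ (forall z, 0 <= f z),
    forall z, (z.2 : R) <= 0 -> f z = 0,
    \forall z \ae mu, f z <= v z `^ lambda,
    EFin \o u = J_heat alpha f %[ae mu] &
    forall T, (slab_pow T p f < +oo)%E].
Proof.
move=> a0 l0 p0 /set_mem[f0 Xf0 uf0] fv v0.
have [] : X_space p (frac_heat alpha p u) /\
    EFin \o u = J_heat alpha (frac_heat alpha p u) %[ae mu].
  by apply: (@xgetPex _ (cst 0) [set f | X_space p f /\
    EFin \o u = J_heat alpha f %[ae mu]]); exists f0.
set g := frac_heat alpha p u in fv *; move=> [mg Xg] uJ.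
(* Almost everywhere this changes nothing: g >= 0, the time t = 0 is null, and for t < 0 one has 0
   <= g <= v^lambda = 0. *)
pose f z : R := if 0 < (z.2 : R) then Num.max (g z) 0 else 0.
have mf : measurable_fun setT f.
  apply: measurable_fun_ifT.
  - by apply: measurable_fun_ltr => //; exact: measurable_snd.
  - by apply: measurable_maxr => //; exact: measurable_cst.
  - exact: measurable_cst.
have gpast : \forall z \ae mu, (z.2 : R) < 0 -> g z = 0.
  apply: ae_imp2 fv v0 => z /andP[gz gv] vz z0.
  by apply/eqP; rewrite eq_le gz (le_trans gv)// vz// powR0// gt_eqF.
have gf : g = f %[ae mu].
  apply: ae_imp2 ae_time_neq0 (filterI fv gpast) => z zn [/andP[gz _] gz0] _.
  rewrite /f; case: ltgtP zn => // z0 _; last exact: gz0.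
  by rewrite max_l.
exists f; split => //.
- split=> // z; rewrite /f; case: ifP => // _; by rewrite le_max lexx orbT.
- by move=> z z0; rewrite /f ltNge z0.
- by apply: ae_imp2 gf fv => z /= gfz /andP[_]; rewrite gfz.
- apply: ae_imp uJ => z /= uz _.
  by rewrite uz//; exact: ae_eq_J_heat.
- move=> T; apply: finite_norm_slab_pow (Xg T) => // z.
  by rewrite /f; case: ifP => // _; rewrite le_max lexx orbT.
Qed.

(** [u] equals its potential only almost everywhere and need not be measurable; [u'] is a measurable
    nonnegative representative, with L^p bounds on slabs inherited from [f]. *)
Lemma heat_bound_fine alpha lambda p f u v : 0 < alpha -> 1 <= p ->
  measurable_fun setT f -> (forall z, 0 <= f z) ->
  (forall z, (z.2 : R) <= 0 -> f z = 0) ->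
  (\forall z \ae mu, f z <= v z `^ lambda) ->
  EFin \o u = J_heat alpha f %[ae mu] ->
  (forall T, (slab_pow T p f < +oo)%E) ->
  let u' z := fine (J_heat alpha f z) in
  [/\ \forall z \ae mu, u z = u' z, heat_bound alpha lambda u' v &
    forall T, 0 < T -> (slab_pow T p u' < +oo)%E].
Proof.
move=> a0 p1 mf f0 fpast fv uJ fp u'.
have mu' : measurable_fun setT u'.
  apply: (measurableT_comp (fine_measurable measurableT)).
  exact: measurable_J_heat.
have u0 z : 0 <= u' z by rewrite fine_ge0// J_heat_ge0.
have uJ' : \forall z \ae mu, ((u' z)%:E <= J_heat alpha f z)%E.
  by apply: ae_imp uJ => z /= /(_ I) uz; rewrite /u' -uz.
split.
- by apply: ae_imp uJ => z /= /(_ I) uz; rewrite /u' -uz.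
- by split => //; exists f.
move=> T T0; apply: (le_lt_trans (slab_pow_J_heat a0 p1 T0 mf f0 fpast mu' u0 uJ')).
by rewrite lte_mul_pinfty// lee_fin powR_ge0.
Qed.

Lemma heat_bound_ae_eq alpha lambda u v v' : (\forall z \ae mu, v z = v' z) ->
  heat_bound alpha lambda u v -> heat_bound alpha lambda u v'.
Proof.
move=> vv' [mu' u0 [f [f0 fpast fv uJ]]]; split => //; exists f; split => //.
by apply: ae_imp2 vv' fv => z ->.
Qed.

Lemma Linfty_norm_le T u (C b : R) : 0 < T -> 0 <= C -> 0 <= b ->
  (\forall z \ae mu, 0 <= u z <= C * ppow b z.2) ->
  (Linfty_norm T u <= (C * T `^ b)%:E)%E.
Proof.
move=> T0 C0 b0 uC; have K0 : 0 <= C * T `^ b by rewrite mulr_ge0 ?powR_ge0.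
rewrite /Linfty_norm unlock /Lnorm; case: ifPn => _; last by rewrite lee_fin.
apply/ess_supP; apply: ae_imp uC => z /andP[u0 uz] /=.
rewrite patchE lee_fin; case: ifPn => [/set_mem/= /andP[z0 zT]|_]; last by rewrite normr0.
rewrite ger0_norm// (le_trans uz)// ler_wpM2l// ppow_gt0//.
by apply: ge0_ler_powR; rewrite ?nnegrE ?(ltW z0) ?(ltW T0) ?(ltW zT).
Qed.

Lemma powR_ratio (x y z t s : R) : 0 < s -> 0 < x -> 0 < y -> 0 < z -> 0 < t ->
  (x / z) `^ s * (y / t) = (x * y `^ s^-1 / (z * t `^ s^-1)) `^ s.
Proof.
move=> s0 x0 y0 z0 t0; have sn0 : s != 0 by rewrite gt_eqF.
have xz : 0 <= x / z by rewrite divr_ge0// ltW.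
rewrite invfM mulrACA -powRN (powRM _ xz (mulr_ge0 (powR_ge0 _ _) (powR_ge0 _ _))).
congr (_ * _); rewrite powRM ?powR_ge0// -!powRrM mulNr mulVf// powRr1 ?(ltW y0)//.
by rewrite powRN powRr1 ?(ltW t0).
Qed.

(** Taking the power sigma out of the product of the two Gamma ratios leaves 1 / sigma on the second
    one, as in M1. *)
Lemma sharp_constE alpha beta lambda sigma
  (gamma1 := (beta + alpha * sigma) * lambda / (1 - lambda * sigma))
  (gamma2 := (alpha + beta * lambda) * sigma / (1 - lambda * sigma)) :
  0 < alpha -> 0 < beta -> 0 < lambda -> 0 < sigma -> lambda * sigma < 1 ->
  sharp_const alpha beta lambda sigma =
  (Gamma (gamma1 + 1) * Gamma (gamma2 + 1) `^ sigma^-1 /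
   (Gamma (alpha + gamma1 + 1) * Gamma (beta + gamma2 + 1) `^ sigma^-1))
  `^ (sigma / (1 - lambda * sigma)).
Proof.
move=> a0 b0 l0 s0 ls1.
have th1 : 0 < 1 - lambda * sigma by rewrite subr_gt0.
have g1E : growth alpha beta lambda sigma * lambda = gamma1 by rewrite /growth mulrAC.
have g2E : growth beta alpha sigma lambda * sigma = gamma2.
  by rewrite /growth mulrAC [sigma * lambda]mulrC.
have g1 : 0 <= gamma1.
  by rewrite divr_ge0 ?(ltW th1)// mulr_ge0 ?(ltW l0)// addr_ge0 ?mulr_ge0 ?(ltW a0) ?(ltW b0) ?(ltW s0).
have g2 : 0 <= gamma2.
  by rewrite divr_ge0 ?(ltW th1)// mulr_ge0 ?(ltW s0)// addr_ge0 ?mulr_ge0 ?(ltW a0) ?(ltW b0) ?(ltW l0).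
rewrite /sharp_const g1E g2E powRrM; congr (_ `^ _).
have G (c : R) : 0 <= c -> 0 < Gamma (c + 1) by move=> c0; rewrite Gamma_gt0//; lra.
have G1 := G _ g1; have G2 := G _ g2.
have G3 := G _ (addr_ge0 (ltW a0) g1); have G4 := G _ (addr_ge0 (ltW b0) g2).
exact: powR_ratio.
Qed.

End representation.

Theorem theorem2p2 (R : realType) (n : nat) (p q lambda sigma alpha beta : R)
  (u v : spacetime R n -> R)
  (gamma1 := (beta + alpha * sigma) * lambda / (1 - lambda * sigma))
  (gamma2 := (alpha + beta * lambda) * sigma / (1 - lambda * sigma))
  (M1 := Gamma (gamma1 + 1) * Gamma (gamma2 + 1) `^ sigma^-1 /
         (Gamma (alpha + gamma1 + 1) * Gamma (beta + gamma2 + 1) `^ sigma^-1))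
  (M2 := Gamma (gamma2 + 1) * Gamma (gamma1 + 1) `^ lambda^-1 /
         (Gamma (beta + gamma2 + 1) * Gamma (alpha + gamma1 + 1) `^ lambda^-1)) :
  (1 <= n)%N ->
  1 <= p -> 1 <= q ->
  0 < lambda -> 0 < sigma -> 0 < alpha -> 0 < beta ->
  (1 < p /\ 0 < alpha < (n%:R + 2) / (2 * p)) \/
  (p = 1 /\ 0 < alpha <= (n%:R + 2) / (2 * p)) ->
  (1 < q /\ 0 < beta < (n%:R + 2) / (2 * q)) \/
  (q = 1 /\ 0 < beta <= (n%:R + 2) / (2 * q)) ->
  (n%:R + 2 - 2 * p * alpha) * q ^+ 2 * sigma <=
    (n%:R + 2 - 2 * q * beta) * p ^+ 2 * lambda ->
  2 * p * alpha < n%:R + 2 ->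
  sigma < 1 / lambda ->
  u \in Y_space alpha p ->
  v \in Y_space beta q ->
  (\forall z \ae spacetime_measure R n,
     0 <= frac_heat alpha p u z <= v z `^ lambda) ->
  (\forall z \ae spacetime_measure R n,
     0 <= frac_heat beta q v z <= u z `^ sigma) ->
  (\forall z \ae spacetime_measure R n, (z.2 : R) < 0 -> u z = 0 /\ v z = 0) ->
  forall T : R, 0 < T ->
    (Linfty_norm T u <=
       (M2 `^ (lambda / (1 - lambda * sigma)) * T `^ (gamma2 / sigma))%:E)%E /\
    (Linfty_norm T v <=
       (M1 `^ (sigma / (1 - lambda * sigma)) * T `^ (gamma1 / lambda))%:E)%E.
Proof.
move=> _ p1 q1 l0 s0 a0 b0 _ _ _ _ sl uY vY fv gu uv0 T T0.
have ls1 : lambda * sigma < 1 by move: sl; rewrite ltr_pdivlMr// mulrC.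
have th1 : 0 < 1 - lambda * sigma by rewrite subr_gt0.
have u0 : \forall z \ae spacetime_measure R n, (z.2 : R) < 0 -> u z = 0.
  by apply: ae_imp uv0 => z h /h[].
have v0 : \forall z \ae spacetime_measure R n, (z.2 : R) < 0 -> v z = 0.
  by apply: ae_imp uv0 => z h /h[].
have [f [[mf f0] fpast {}fv uJ fp]] :=
  frac_heat_representation a0 l0 (lt_le_trans ltr01 p1) uY fv v0.
have [g [[mg g0] gpast {}gu vJ gq]] :=
  frac_heat_representation b0 s0 (lt_le_trans ltr01 q1) vY gu u0.
(* Both unknowns are replaced by their potentials; since each source is bounded by the other
   unknown, [heat_bound_ae_eq] must exchange that one too. *)
have [uE uv up] := heat_bound_fine a0 p1 mf f0 fpast fv uJ fp.
have [vE vu vq] := heat_bound_fine b0 q1 mg g0 gpast gu vJ gq.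
have [uB vB] := heat_bound_sharp_system a0 b0 l0 s0 ls1 p1 q1
  (heat_bound_ae_eq vE uv) (heat_bound_ae_eq uE vu) up vq.
have sl1 : sigma * lambda < 1 by rewrite mulrC.
split.
(* The bound for [u] is the one for [v] with (alpha, lambda) and (beta, sigma) exchanged, which
   turns M1 into M2. *)
- have -> : gamma2 / sigma = growth beta alpha sigma lambda.
    by rewrite /gamma2 /growth [sigma * lambda]mulrC mulrAC mulfK// gt_eqF.
  have -> : M2 `^ (lambda / (1 - lambda * sigma)) = sharp_const beta alpha sigma lambda.
    by rewrite (sharp_constE b0 a0 s0 l0 sl1) /M2 /gamma1 /gamma2 [sigma * lambda]mulrC.
  apply: Linfty_norm_le => //; first exact: powR_ge0.
    by rewrite divr_ge0 ?subr_ge0 ?(ltW sl1)// addr_ge0 ?mulr_ge0 ?ltW.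
  apply: ae_imp2 uE uB => z -> ->; rewrite andbT.
  by rewrite fine_ge0// J_heat_ge0.
- have -> : gamma1 / lambda = growth alpha beta lambda sigma.
    by rewrite /gamma1 /growth mulrAC mulfK// gt_eqF.
  have -> : M1 `^ (sigma / (1 - lambda * sigma)) = sharp_const alpha beta lambda sigma.
    by rewrite (sharp_constE a0 b0 l0 s0 ls1).
  apply: Linfty_norm_le => //; first exact: powR_ge0.
    by rewrite divr_ge0 ?subr_ge0 ?(ltW ls1)// addr_ge0 ?mulr_ge0 ?ltW.
  apply: ae_imp2 vE vB => z -> ->; rewrite andbT.
  by rewrite fine_ge0// J_heat_ge0.
Qed.
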